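(* Let $d\ge3$ and $n\ge1$. For each $j\in[d]$ and each $(d-1)$-tuple $(i_1,\dots,i_{j-1},i_{j+1},\dots,i_d)\in[n]^{d-1}$ let $A^{(j)}_{i_1,\dots,i_{j-1},i_{j+1},\dots,i_d}$ be a random variable, all these variables being independent and uniform on $[0,1]$, and set \[ W_{i_1,\dots,i_d}=\sum_{j=1}^d A^{(j)}_{i_1,\dots,i_{j-1},i_{j+1},\dots,i_d}. \] Let \[ Z_n=\min\Big\{\sum_{i=1}^n W_{i,\sigma_1(i),\dots,\sigma_{d-1}(i)} : \sigma_1,\dots,\sigma_{d-1}\text{ permutations of }[n]\Big\}. \] Then there exist constants $c_d,C_d>0$ such that (a) $\mathbf{E}(Z_n)\ge c_d n^{1/d}$, and (b) the algorithm GREEDY$(m)$ with $m=n-n^{1/(d+1)}$, with the final completion step made arbitrarily, outputs an assignment whose expected total cost is at most $C_d n^{1/d}$.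
   Context: The $d$-dimensional algorithm GREEDY$(m)$: set $B_1=\dots=B_{d-1}:=[n]$ and $T:=\emptyset$. For $i=1,\dots,m$: choose $(j_1,\dots,j_{d-1})\in B_1\times\dots\times B_{d-1}$ minimizing $W_{i,j_1,\dots,j_{d-1}}$; add $(i,j_1,\dots,j_{d-1})$ to $T$ and remove $j_r$ from $B_r$ for each $r\in[d-1]$. Finally complete $T$ arbitrarily to permutations $\sigma_1,\dots,\sigma_{d-1}$ of $[n]$ with $\sigma_r(i)=j_r$ for each $(i,j_1,\dots,j_{d-1})\in T$; the cost of the output is $\sum_{i=1}^n W_{i,\sigma_1(i),\dots,\sigma_{d-1}(i)}$. *)

(* Defs.v *)
From HB Require Import structures.
From mathcomp Require Import all_boot all_order all_algebra all_fingroup.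
From mathcomp Require Import all_classical all_reals all_analysis.

Set Implicit Arguments.
Unset Strict Implicit.
Unset Printing Implicit Defensive.

Import Order.TTheory GRing.Theory Num.Theory.
Local Open Scope classical_set_scope.
Local Open Scope ring_scope.

(* Coordinates and indices are 0-based: [d] is 'I_d and [n] is 'I_n. *)

Section Assignment.
Variables (R : realType) (d n : nat).

Definition multi_index := {ffun 'I_d -> 'I_n}.
Definition sub_index := {ffun 'I_d.-1 -> 'I_n}.

Definition del_coord (j : 'I_d) (x : multi_index) : sub_index :=
  [ffun k => x (lift j k)].

Definition weight (A : 'I_d -> sub_index -> R) (x : multi_index) : R :=
  \sum_(j < d) A j (del_coord j x).

Definition perms := {ffun 'I_d.-1 -> {perm 'I_n}}.

End Assignment.

Arguments multi_index : clear implicits.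
Arguments sub_index : clear implicits.
Arguments perms : clear implicits.

(* The index (i, j_1, ..., j_(d-1)); the match only serves to see 'I_d as
   coordinate 0 followed by 'I_d.-1, and d = 0 is irrelevant. *)
Definition cons_index (d n : nat) (i : 'I_n) : sub_index d n -> multi_index d n :=
  match d return sub_index d n -> multi_index d n with
  | 0 => fun=> [ffun=> i]
  | d'.+1 => fun j => [ffun k => oapp j i (unlift ord0 k)]
  end.

Section Greedy.
Variables (R : realType) (d n : nat).

Definition cost (W : multi_index d n -> R) (sigma : perms d n) : R :=
  \sum_(i < n) W (cons_index i [ffun r => sigma r i]).

(* The default value of the iterated minimum is itself one of the costs, so
   this is the minimum over all families of permutations. *)
Definition min_cost (W : multi_index d n -> R) : R :=
  \big[Order.min/cost W [ffun=> 1%g]]_(sigma : perms d n) cost W sigma.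

Definition in_box (B : {ffun 'I_d.-1 -> {set 'I_n}}) (j : sub_index d n) : Prop :=
  forall r, j r \in B r.

(* [greedy_run W m B T]: (B, T) is a possible state of the algorithm after
   its first m rounds, ties being broken in any way. The element
   (i, j_1, ..., j_(d-1)) of T is stored as the pair (i, j). *)
Inductive greedy_run (W : multi_index d n -> R) :
    nat -> {ffun 'I_d.-1 -> {set 'I_n}} -> {set 'I_n * sub_index d n} -> Prop :=
| greedy_init : greedy_run W 0 [ffun=> [set: 'I_n]%SET] finset.set0
| greedy_step (i : 'I_n) B T (j : sub_index d n) :
    greedy_run W i B T ->
    in_box B j ->
    (forall j', in_box B j' -> W (cons_index i j) <= W (cons_index i j')) ->
    greedy_run W i.+1 [ffun r => (B r :\ j r)%SET] ((i, j) |: T)%SET.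

Definition greedy_output (W : multi_index d n -> R) (m : nat) (sigma : perms d n) :
    Prop :=
  exists B T, greedy_run W m B T /\
    forall i j, (i, j) \in T -> forall r, sigma r i = j r.

End Greedy.

Section Probability.
Context (R : realType) (dO : measure_display) (Omega : measurableType dO).
Variable P : probability Omega R.

Definition mutually_independent (I : finType) (X : I -> {RV P >-> R}) : Prop :=
  forall (J : {set I}) (E : I -> set R), (forall i, measurable (E i)) ->
    P (\bigcap_(i in [set` J]) X i @^-1` E i) =
    (\prod_(i in J) P (X i @^-1` E i))%E.

Definition uniform01 (X : {RV P >-> R}) : Prop :=
  forall E : set R, measurable E ->
    distribution P X E = uniform_prob (@ltr01 R) E.

End Probability.

(* n - n^(1/(d+1)) rounded down: the number of integers i >= 1 that are at
   most this real number. *)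
Definition greedy_rounds (R : realType) (d n : nat) : nat :=
  Num.truncn (n%:R - n%:R `^ (d.+1%:R^-1) : R).

(* Main.v *)
(* Write e = d - 1. Lower bound: a fixed row contains n^e entries, and an entry
   of weight below x has all its d uniform summands below x, so with
   x ~ n^(-e/d) the row minimum is at least x with probability at least 1/2.

   Upper bound: when the remaining box has side k, the row minimum has mean
   O(k^(-e/d)), and these means add up to O(n^(1/d)). The box depends on the
   previous rows and on the array A^(1), which is shared by all rows; the other
   arrays are fresh in the current row. So A^(1) is controlled for all boxes of
   side k at once. For each scale s <= k^(1/d), cut a box into subcubes of side
   4s and call a value low if it is below s^(-e). By a union bound (this is
   where k >= n^(1/(d+1)) is needed), it is likely that in every box at least
   half of the subcubes contain a low value of A^(1). Given this, the second
   moment method applied to one low entry per subcube shows that the row has an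
   entry of weight at most d s^(-e) with the required probability. Summing over
   s bounds the mean of the row minimum.

   All probabilities are computed by counting, after rounding the uniform
   variables down to multiples of 1/N. For large N two competing entries rarely
   have nearly equal rounded weights, and otherwise the choices of the algorithm
   are determined by the rounded values, whatever the tie-breaking. *)
Require Import Defs.
From HB Require Import structures.
From mathcomp Require Import all_boot all_order all_algebra all_fingroup.
From mathcomp Require Import all_classical all_reals all_analysis.
From mathcomp Require Import measurable_realfun ring lra zify.
Import Order.TTheory GRing.Theory Num.Theory.
Set Implicit Arguments.
Unset Strict Implicit.
Unset Printing Implicit Defensive.
Local Open Scope ring_scope.

(** * Averages over finite types *)

Lemma card_ord_lt (N X : nat) : (X <= N)%N -> #|[set v : 'I_N | (v < X)%N]| = X.
Proof.
move=> XN; have widen_inj : injective (widen_ord XN).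
  by move=> u v /(congr1 val)/= /ord_inj.
rewrite -[RHS]card_ord -(card_imset _ widen_inj).
apply: eq_card => v; rewrite inE; apply/idP/imsetP => [vX|[w _ ->]//=].
by exists (Ordinal vX) => //; apply/val_inj.
Qed.

Section Average.
Variable R : realFieldType.
Implicit Types T I : finType.

Definition avg T (F : T -> R) : R := (\sum_t F t) / #|T|%:R.

Lemma ler_avg T (F G : T -> R) : (forall t, F t <= G t) -> avg F <= avg G.
Proof.
by move=> FG; rewrite ler_wpM2r ?invr_ge0 ?ler0n//; apply: ler_sum => t _.
Qed.

Lemma eq_avg T (F G : T -> R) : F =1 G -> avg F = avg G.
Proof. by move=> FG; rewrite /avg (eq_bigr G). Qed.

Lemma avgD T (F G : T -> R) : avg (fun t => F t + G t) = avg F + avg G.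
Proof. by rewrite /avg big_split mulrDl. Qed.

Lemma avgZ T (a : R) (F : T -> R) : avg (fun t => a * F t) = a * avg F.
Proof. by rewrite /avg -mulr_sumr mulrA. Qed.

Lemma avg_sum T (J : Type) (s : seq J) (P : pred J) (F : J -> T -> R) :
  avg (fun t => \sum_(j <- s | P j) F j t) = \sum_(j <- s | P j) avg (F j).
Proof. by rewrite /avg exchange_big/= mulr_suml. Qed.

Lemma avg_cst T (a : R) : (0 < #|T|)%N -> avg (fun _ : T => a) = a.
Proof.
move=> T0; rewrite /avg sumr_const -[a *+ _]mulr_natr mulfK//.
by rewrite pnatr_eq0 -lt0n.
Qed.

Lemma ler_avg_cst T (F : T -> R) (a : R) : 0 <= a ->
  (forall t, F t <= a) -> avg F <= a.
Proof.
move=> a0 Fa; have [T0|] := posnP #|T|.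
  by rewrite /avg T0 invr0 mulr0.
by move=> T0; rewrite -[leRHS](avg_cst _ T0); exact: ler_avg.
Qed.

Lemma avg_exists T (J : finType) (P : pred J) (A : J -> pred T) :
  avg (fun t => [exists j, P j && A j t]%:R) <= \sum_(j | P j) avg (fun t => (A j t)%:R).
Proof.
rewrite -avg_sum; apply: ler_avg => t.
case: existsP => [[j /andP[Pj Aj]]|_]; last by apply: sumr_ge0 => j _; rewrite ler0n.
by rewrite (bigD1 j)//= Aj lerDl; apply: sumr_ge0 => i _; rewrite ler0n.
Qed.

Definition resample I T (K : {set I}) (f h : {ffun I -> T}) : {ffun I -> T} :=
  [ffun p => if p \in K then h p else f p].

(* [(f, h) |-> (resample K f h, resample K h f)] is an involution. *)
Lemma avg_resample I T (K : {set I}) (F : {ffun I -> T} -> R) :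
  avg F = avg (fun f => avg (fun h => F (resample K f h))).
Proof.
have [T0|T0] := posnP #|{ffun I -> T}|.
  by rewrite /avg T0 !invr0 !mulr0.
transitivity (avg (fun p : {ffun I -> T} * {ffun I -> T} => F (resample K p.1 p.2))); last first.
  rewrite /avg card_prod natrM invfM mulrA -(pair_bigA _ (fun f h => F (resample K f h)))/=.
  by rewrite -mulr_suml.
pose s (p : {ffun I -> T} * {ffun I -> T}) := (resample K p.1 p.2, resample K p.2 p.1).
have sK : involutive s.
  move=> [f h]; congr (_, _); apply/ffunP => p; rewrite !ffunE;
  by case: ifP => // pK; rewrite pK.
rewrite /avg (reindex_inj (can_inj sK))/=.
under [in RHS]eq_bigr => p _.
  have -> : resample K (resample K p.1 p.2) (resample K p.2 p.1) = p.1.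
    by have := congr1 fst (sK p).
  over.
rewrite card_prod natrM -(pair_bigA _ (fun f h : {ffun I -> T} => F f))/=.
under [in RHS]eq_bigr do rewrite sumr_const -[_ *+ _]mulr_natr.
rewrite -mulr_suml invfM mulrA [X in _ = X / _]mulrAC -mulrA [X in _ = X / _]mulrC.
by rewrite [in RHS]mulrC mulrA mulfVK// pnatr_eq0 -lt0n.
Qed.

Lemma card_ffun_forall_in I T (U : {set I}) (V : {set T}) :
  #|[set h : {ffun I -> T} | [forall p in U, h p \in V]]|
  = (#|V| ^ #|U| * #|T| ^ (#|I| - #|U|))%N.
Proof.
pose F (p : I) : pred T := fun v => (p \in U) ==> (v \in V).
rewrite (eq_card (B := family F)); last first.
  by move=> h; rewrite !inE.
rewrite card_family foldrE big_map big_enum/= (bigID (mem U))/=.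
rewrite (eq_bigr (fun=> #|V|)); last first.
  by move=> p pU; apply: eq_card => v; rewrite unfold_in /F pU.
rewrite prod_nat_const; congr (_ * _)%N.
rewrite (eq_bigr (fun=> #|T|)); last first.
  by move=> p pU; apply: eq_card => v; rewrite unfold_in /F (negbTE pU).
rewrite prod_nat_const -(cardC (mem U)) addKn.
by congr (_ ^ _)%N; apply: eq_card => p; rewrite !inE.
Qed.

(** The coordinates of a uniformly drawn function are independent. With [avg_resample] this replaces
    the product measure. *)
Lemma avg_forall_in I T (U : {set I}) (V : {set T}) : (0 < #|T|)%N ->
  avg (fun h : {ffun I -> T} => [forall p in U, h p \in V]%:R)
  = (#|V|%:R / #|T|%:R) ^+ #|U|.
Proof.
move=> T0; rewrite /avg -natr_sum -big_mkcond sum1dep_card card_ffun_forall_in card_ffun.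
have UI : (#|U| <= #|I|)%N by exact: max_card.
rewrite natrM !natrX expr_div_n -{2}(subnKC UI) exprD invfM mulrACA mulfV ?mulr1//.
by rewrite expf_neq0// pnatr_eq0 -lt0n.
Qed.

(** Chebyshev's inequality for the number [X] of events of [Q] that occur: if [X = 0] then
    [(X - mu) ^ 2 = mu ^ 2], where [mu] is the mean, and the variance is [E(X ^ 2) - mu ^ 2]. *)
Lemma second_moment T (C : finType) (Q : {set C}) (E : C -> pred T) (a : R) :
  (0 < #|T|)%N -> 0 < a -> (0 < #|Q|)%N ->
  (forall c, c \in Q -> avg (fun t => (E c t)%:R) = a) ->
  avg (fun t => (~~ [exists c in Q, E c t])%:R) <=
  (\sum_(c in Q) \sum_(c' in Q) avg (fun t => (E c t && E c' t)%:R)) / (#|Q|%:R * a) ^+ 2 - 1.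
Proof.
move=> T0 a0 Q0 Ea; set mu := #|Q|%:R * a.
have mu0 : 0 < mu by rewrite mulr_gt0 ?ltr0n.
pose X t : R := \sum_(c in Q) (E c t)%:R.
have avgX : avg X = mu.
  by rewrite /X avg_sum (eq_bigr (fun=> a))// sumr_const -[_ *+ _]mulr_natl.
have avgX2 : avg (fun t => X t ^+ 2) =
    \sum_(c in Q) \sum_(c' in Q) avg (fun t => (E c t && E c' t)%:R).
  under [RHS]eq_bigr => c _ do rewrite -avg_sum.
  rewrite -avg_sum; apply: eq_avg => t; rewrite expr2 mulr_suml.
  apply: eq_bigr => c _; rewrite mulr_sumr; apply: eq_bigr => c' _.
  by rewrite -natrM mulnb.
have mu2 : 0 < mu ^+ 2 by exact: exprn_gt0.
rewrite -avgX2 lerBrDr ler_pdivlMr// mulrDl mul1r mulrC -avgZ.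
have -> : avg (fun t => X t ^+ 2) =
    avg (fun t => (X t - mu) ^+ 2) + mu ^+ 2.
  have -> : avg (fun t => X t ^+ 2) =
      avg (fun t => (X t - mu) ^+ 2 + (2 * mu * X t + - mu ^+ 2)).
    by apply: eq_avg => t; ring.
  by rewrite !avgD avgZ avgX avg_cst//; ring.
rewrite lerD2r; apply: ler_avg => t.
have [/existsP[c cE]|nE] := boolP [exists c in Q, E c t].
  by rewrite mulr0 sqr_ge0.
rewrite mulr1 (_ : X t = 0) ?sub0r ?sqrrN//.
apply: big1 => c cQ; case Ect : (E c t) => //.
by case/negP: nE; apply/existsP; exists c; rewrite cQ Ect.
Qed.

End Average.

(** * Entries, rows and subcubes *)

Section Index.
Variables (e n : nat).
Implicit Types (i : 'I_n) (j : sub_index e.+1 n).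

(* The coordinate [(l, del_coord l x)] of the array summed in the weight of
   [x = cons_index i j]. *)
Definition entry i j (l : 'I_e.+1) : 'I_e.+1 * sub_index e.+1 n :=
  (l, del_coord l (cons_index i j)).

Lemma cons_indexS i j r : cons_index i j (lift ord0 r) = j r.
Proof. by rewrite ffunE liftK. Qed.

Lemma entry0 i j : entry i j ord0 = (ord0, j).
Proof. by congr (_, _); apply/ffunP => r; rewrite ffunE cons_indexS. Qed.

(** Deleting a column coordinate keeps the row number and all other columns, so entries of a row
    share a variable exactly along an axis line. *)
Lemma del_cons_eq i j j' (l : 'I_e) :
  (del_coord (lift ord0 l) (cons_index i j) = del_coord (lift ord0 l) (cons_index i j'))
  <-> (forall r, r != l -> j r = j' r).
Proof.
split=> [/ffunP E r rl|E].
  have : lift ord0 l != lift ord0 r by rewrite (inj_eq lift_inj) eq_sym.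
  case/unlift_some => k kE _; have := E k.
  by rewrite !ffunE -kE !liftK.
apply/ffunP => k; rewrite !ffunE; case: unliftP => //= r rE.
by apply: E; apply: contraTneq (neq_lift (lift ord0 l) k) => E; rewrite rE E eqxx.
Qed.

(** The variables of row [i] outside array [ord0]. They keep [i] as a coordinate, so no other row
    uses them ([entry_notin_row]). *)
Definition row_entries i : {set 'I_e.+1 * sub_index e.+1 n} :=
  [set entry i p.1 (lift ord0 p.2) | p : sub_index e.+1 n * 'I_e].

Lemma entry_row i j l : entry i j (lift ord0 l) \in row_entries i.
Proof. by apply/imsetP; exists (j, l). Qed.

Lemma entry0_notin_row i i' j : entry i' j ord0 \notin row_entries i.
Proof.
by apply/negP => /imsetP[[j' l] _ /(congr1 fst)/eqP]; rewrite /= (negbTE (neq_lift _ _)).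
Qed.

Lemma entry_notin_row (e0 : (0 < e)%N) i i' j l : i' != i ->
  entry i' j l \notin row_entries i.
Proof.
move=> ii'; apply/negP => /imsetP[[j' l'] _ [-> /ffunP/(_ (Ordinal e0))]].
rewrite !ffunE.
have -> : lift (lift ord0 l') (Ordinal e0) = ord0 by apply/val_inj.
by rewrite unlift_none/= => /eqP; rewrite (negbTE ii').
Qed.

Definition row_set i j := [set entry i j (lift ord0 l) | l : 'I_e].

Lemma card_row_set i j : #|row_set i j| = e.
Proof.
by rewrite card_imset ?card_ord// => l l' /(congr1 fst)/lift_inj.
Qed.

(** Inclusion-exclusion: one variable is shared for each direction in which [j] and [j'] lie on a
    common line. Distinct points have at most one such direction ([agree_off_unique]). *)
Lemma card_row_setU i j j' :
  (#|row_set i j :|: row_set i j'| + #|[set l : 'I_e | [forall (r | r != l), j r == j' r]]|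
    = e + e)%N.
Proof.
transitivity (#|row_set i j| + #|row_set i j'|)%N; last by rewrite !card_row_set.
rewrite -cardsUI; congr addn.
rewrite -(card_imset _ (_ : injective (fun l : 'I_e => entry i j (lift ord0 l)))); last first.
  by move=> l l' /(congr1 fst)/lift_inj.
apply: eq_card => p; rewrite !inE; apply/imsetP/andP => [[l lE ->]|[/imsetP[l _ ->] /imsetP[l' _ E]]].
  split; apply/imsetP; exists l => //.
  congr (_, _); apply/del_cons_eq => r rl.
  by move: lE; rewrite inE => /forall_inP/(_ r rl)/eqP.
exists l => //; rewrite inE; have ll' : l = l' by have /lift_inj := congr1 fst E.
have {}E : del_coord (lift ord0 l) (cons_index i j) = del_coord (lift ord0 l) (cons_index i j').
  by move/(congr1 snd): E; rewrite /= -ll'.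
move/del_cons_eq: E => E.
by apply/forall_inP => r /E ->.
Qed.

Lemma agree_off_unique j j' (l l' : 'I_e) : j != j' ->
  (forall r, r != l -> j r = j' r) -> (forall r, r != l' -> j r = j' r) -> l = l'.
Proof.
move=> jj' Hl Hl'; apply/eqP; apply: contraNT jj' => ll'.
apply/eqP/ffunP => r; have [->|/Hl//] := eqVneq r l; exact: Hl'.
Qed.

End Index.
Arguments row_entries {e n}.

Section Cells.
Variables (e n k q b : nat) (i0 : 'I_n).
Hypothesis qbk : (q * b <= k)%N.
Notation cell := {ffun 'I_e -> 'I_q}.
Notation box := {ffun 'I_e -> {set 'I_n}}.
Implicit Type B : box.

(* Listing each side of a box [B] of side [k] identifies [B] with the cube
   [[0, k)^e], in which [c] names the subcube of side [b] with corner [b c]. *)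
Definition point B (c : cell) (o : {ffun 'I_e -> 'I_b}) : sub_index e.+1 n :=
  [ffun r => nth i0 (enum (B r)) (c r * b + o r)].

Lemma cell_lt (c : 'I_q) (o : 'I_b) : (c * b + o < k)%N.
Proof.
apply: leq_trans qbk; apply: (@leq_trans (c * b + b)%N).
  by rewrite ltn_add2l.
by rewrite -mulSnr leq_mul2r ltn_ord orbT.
Qed.

Lemma point_in B c o r : #|B r| = k -> point B c o r \in B r.
Proof.
by move=> Bk; rewrite ffunE -mem_enum mem_nth// -cardE Bk cell_lt.
Qed.

Lemma point_inj B c c' o o' r : #|B r| = k ->
  point B c o r = point B c' o' r -> c r = c' r /\ o r = o' r.
Proof.
move=> Bk; rewrite !ffunE => /eqP.
rewrite nth_uniq ?enum_uniq -?cardE ?Bk ?cell_lt// => /eqP E.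
have b0 : (0 < b)%N by exact: leq_ltn_trans (ltn_ord (o r)).
split; apply/val_inj => /=.
  by have := congr1 (divn^~ b) E; rewrite !divnMDl// !divn_small// !addn0.
by have := congr1 (modn^~ b) E; rewrite !modnMDl !modn_small.
Qed.

End Cells.

Lemma bin_leq_exp m k : ('C(m, k) <= m ^ k)%N.
Proof.
rewrite -(leq_pmul2r (fact_gt0 k)) bin_ffact.
apply: (@leq_trans (m ^ k)); last by rewrite leq_pmulr// fact_gt0.
by elim: k => // k IH; rewrite ffactnSr expnSr leq_mul// leq_subr.
Qed.

(** * One row of a fixed box *)

Section Regularity.
Variables (R : realFieldType) (e n N k q b X : nat) (i0 : 'I_n).
Hypothesis qbk : (q * b <= k)%N.
Hypotheses (b0 : (0 < b)%N) (q0 : (0 < q)%N) (N0 : (0 < N)%N).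
Hypotheses (X0 : (0 < X)%N) (XN : (X <= N)%N).
Notation cell := {ffun 'I_e -> 'I_q}.
Notation box := {ffun 'I_e -> {set 'I_n}}.
Notation env := {ffun 'I_e.+1 * sub_index e.+1 n -> 'I_N}.
Implicit Types (B : box) (f h : env) (i : 'I_n) (c : cell).

Definition hit i (j : sub_index e.+1 n) f := [forall l, f (entry i j l) < X]%N.

Definition miss i B f :=
  ~~ [exists j : sub_index e.+1 n, [forall r, j r \in B r] && hit i j f].

Definition empty_cell B f c :=
  [forall o : {ffun 'I_e -> 'I_b}, X <= f (ord0, point i0 B c o)]%N.

(* Depends on [f] only through the array of index [ord0]. *)
Definition irregular f :=
  [exists B : box, [forall r, #|B r| == k] &&
    (q ^ e <= (#|[set c | empty_cell B f c]|).*2)%N].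

Let p : R := X%:R / N%:R.

Let p0 : 0 < p. Proof. by rewrite divr_gt0 ?ltr0n. Qed.

Let p1 : p <= 1. Proof. by rewrite ler_pdivrMr ?ltr0n// mul1r ler_nat. Qed.

Let low : {set 'I_N} := [set v : 'I_N | (v < X)%N].

Let card_low : #|low| = X. Proof. exact: card_ord_lt. Qed.

Lemma card_agree_off c (l : 'I_e) :
  (#|[set c' : cell | [forall (r | r != l), c r == c' r]]| <= q)%N.
Proof.
rewrite -[leqRHS]card_ord.
rewrite -(card_in_imset (f := fun c' : cell => c' l)); first exact: max_card.
move=> c1 c2; rewrite !inE => /forall_inP H1 /forall_inP H2 E.
apply/ffunP => r; have [->//|rl] := eqVneq r l.
by rewrite -(eqP (H1 r rl)) -(eqP (H2 r rl)).
Qed.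

(* Second moment over one entry below [X] in each nonempty cell. Hits at two
   entries are independent unless these entries lie on a common axis line, which
   has at most [q] cells. *)
Lemma avg_miss_regular i B f : (forall r, #|B r| = k) -> ~~ irregular f ->
  avg (fun h => (miss i B (resample (row_entries i) f h))%:R) <=
  2 / (q%:R * p) ^+ e + 2 * e%:R * q%:R / (q%:R ^+ e * p) :> R.
Proof.
move=> Bk reg.
pose o0 : {ffun 'I_e -> 'I_b} := [ffun=> Ordinal b0].
(* One low entry of array [ord0] is fixed in each nonempty cell; [o0] is a default for empty cells.
   The choice depends on [f] alone, not on the resampled [h]. *)
pose o c := odflt o0 [pick o | (f (ord0, point i0 B c o) < X)%N].
pose pt c := point i0 B c (o c).
pose Q : {set cell} := [set c | ~~ empty_cell B f c].
have ptX c : c \in Q -> (f (ord0, pt c) < X)%N.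
  rewrite inE negb_forall => /existsP[u Hu]; rewrite /pt /o.
  by case: pickP => [//|H]; move: Hu; rewrite -ltnNge H.
have ptI c c' l : (forall r, r != l -> pt c r = pt c' r) -> forall r, r != l -> c r = c' r.
  by move=> E r rl; case: (point_inj qbk (Bk r) (E r rl)).
pose E c h := [forall u in row_set i (pt c), h u \in low].
have Qhalf : (q ^ e < (#|Q|).*2)%N.
  move: reg; rewrite negb_exists => /forallP/(_ B).
  rewrite negb_and -ltnNge => /orP[/negP[]|].
    by apply/forallP => r; rewrite Bk.
  have -> : #|Q| = (q ^ e - #|[set c | empty_cell B f c]|)%N.
    have -> : (q ^ e)%N = #|{: cell}| by rewrite card_ffun !card_ord.
    rewrite -(cardsC [set c | empty_cell B f c]%SET) addKn.
    by apply: eq_card => c; rewrite !inE.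
  lia.
have Q0 : (0 < #|Q|)%N by rewrite -double_gt0 (leq_ltn_trans _ Qhalf).
have T0 : (0 < #|'I_N|)%N by rewrite card_ord.
have H0 : (0 < #|{: env}|)%N by rewrite card_ffun expn_gt0 T0.
have Ea c : avg (fun h => (E c h)%:R) = p ^+ e.
  by rewrite avg_forall_in// card_row_set card_low card_ord.
(* Array [ord0] is not resampled and is low at [pt c], so [pt c] is hit once its [e] other
   variables, now read from [h], are low. *)
have missE h : miss i B (resample (row_entries i) f h) ->
    ~~ [exists c in Q, E c h].
  apply: contra => /existsP[c /andP[cQ /forall_inP Ec]].
  apply/existsP; exists (pt c); apply/andP; split.
    by apply/forallP => r; exact: (point_in i0 qbk _ _ (Bk r)).
  apply/forallP => l; rewrite ffunE.
  case: (unliftP ord0 l) => [l'|] ->; last first.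
    by rewrite (negbTE (entry0_notin_row _ _ _)) entry0 ptX.
  by rewrite entry_row; have := Ec (entry i (pt c) (lift ord0 l')) (imset_f _ isT); rewrite inE.
apply: (@le_trans _ _ (avg (fun h => (~~ [exists c in Q, E c h])%:R))).
  apply: ler_avg => h; rewrite ler_nat; case: (boolP (miss _ _ _)) => // /missE ->//.
apply: le_trans (second_moment H0 (exprn_gt0 e p0) Q0 (fun c _ => Ea c)) _.
(* The three terms account for equal cells, points sharing one variable, and points with disjoint
   variables. *)
have pairE c c' : c \in Q -> c' \in Q ->
    avg (fun h => (E c h && E c' h)%:R) <=
    (c == c')%:R * p ^+ e + \sum_(l < e) [forall (r | r != l), c r == c' r]%:R * p ^+ (2 * e).-1
      + p ^+ (2 * e) :> R.
  move=> cQ c'Q.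
  have -> : avg (fun h => (E c h && E c' h)%:R) = p ^+ #|row_set i (pt c) :|: row_set i (pt c')| :> R.
    have -> : p = #|low|%:R / #|'I_N|%:R by rewrite card_low card_ord.
    rewrite -avg_forall_in//.
    apply: eq_avg => h; congr (nat_of_bool _)%:R.
    apply/andP/forall_inP => [[/forall_inP H1 /forall_inP H2] u|H].
      by rewrite inE => /orP[/H1|/H2].
    by split; apply/forall_inP => u uc; apply: H; rewrite inE uc ?orbT.
  have S0 c1 c2 : 0 <= \sum_(l < e) [forall (r | r != l), (c1 : cell) r == (c2 : cell) r]%:R * p ^+ (2 * e).-1 :> R.
    by apply: sumr_ge0 => l _; rewrite mulr_ge0 ?ler0n// exprn_ge0// ltW.
  have P0 m : 0 <= p ^+ m by rewrite exprn_ge0// ltW.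
  have [->|cc'] := eqVneq c c'.
    rewrite finset.setUid card_row_set mul1r -addrA lerDl addr_ge0//.
  rewrite mul0r add0r.
  have := card_row_setU i (pt c) (pt c').
  set D := finset (fun l : 'I_e => [forall (r | r != l), _]); have [D0|[l lD]] := set_0Vmem D.
    by rewrite D0 cards0 addn0 addnn -mul2n => ->; rewrite lerDr.
  have ptcc' : pt c != pt c'.
    apply: contraNneq cc' => E'; apply/eqP/ffunP => r.
    by have [] := point_inj qbk (Bk r) (congr1 (fun g : sub_index e.+1 n => g r) E').
  have Dl l' : l' \in D -> forall r, r != l' -> pt c r = pt c' r.
    by rewrite inE => /forall_inP H r /H/eqP.
  have -> : D = [set l]%SET.
    apply/setP => l'; rewrite finset.in_set1; apply/idP/eqP => [l'D|->//].
    exact: agree_off_unique ptcc' (Dl _ l'D) (Dl _ lD).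
  rewrite cards1 => cU.
  have -> : #|row_set i (pt c) :|: row_set i (pt c')| = (2 * e).-1 by lia.
  rewrite (bigD1 l)//=; have -> : [forall (r | r != l), c r == c' r].
    by apply/forall_inP => r rl; apply/eqP; apply: ptI (Dl _ lD) r rl.
  rewrite mul1r -addrA lerDl addr_ge0//.
  by apply: sumr_ge0 => l' _; rewrite mulr_ge0 ?ler0n.
set m : R := #|Q|%:R; have m0 : 0 < m by rewrite ltr0n.
have pe0 : 0 < p ^+ e by exact: exprn_gt0.
have pee : p ^+ (2 * e) = p ^+ e ^+ 2 by rewrite mulnC exprM.
apply: (@le_trans _ _ (((m * p ^+ e + m * (e%:R * q%:R * p ^+ (2 * e).-1))
    + m * (m * p ^+ (2 * e))) / (m * p ^+ e) ^+ 2 - 1)).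
  rewrite lerB// ler_wpM2r ?invr_ge0 ?sqr_ge0//.
  have -> : m * p ^+ e + m * (e%:R * q%:R * p ^+ (2 * e).-1) + m * (m * p ^+ (2 * e)) =
      \sum_(c in Q) (p ^+ e + e%:R * q%:R * p ^+ (2 * e).-1 + m * p ^+ (2 * e)).
    by rewrite sumr_const -[_ *+ _]mulr_natl -/m; ring.
  apply: ler_sum => c cQ; apply: le_trans (ler_sum _ (fun c' => pairE c c' cQ)) _.
  rewrite !big_split/= lerD//; last by rewrite sumr_const -[_ *+ _]mulr_natl.
  rewrite lerD//.
    rewrite (bigD1 c)//= eqxx mul1r big1 ?addr0// => c' /andP[_ /negbTE].
    by rewrite eq_sym => ->; rewrite mul0r.
  rewrite exchange_big/=.
  apply: (@le_trans _ _ (\sum_(l < e) q%:R * p ^+ (2 * e).-1)); last first.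
    by rewrite sumr_const card_ord -[_ *+ _]mulr_natl mulrA.
  apply: ler_sum => l _; rewrite -mulr_suml ler_wpM2r ?exprn_ge0 ?(ltW p0)//.
  rewrite -natr_sum ler_nat; apply: leq_trans (card_agree_off c l).
  rewrite -sum1_card [leqRHS]big_mkcond [leqLHS]big_mkcond/=.
  by apply: leq_sum => c' _; rewrite !inE; case: ifP => //; case: [forall (r | r != l), _].
have -> : e%:R * q%:R * p ^+ (2 * e).-1 = e%:R * q%:R * p ^+ e ^+ 2 / p.
  rewrite -pee; case: (e) => [|e']; first by rewrite !mul0r.
  by rewrite [in RHS](_ : 2 * e'.+1 = (2 * e'.+1).-1.+1)%N ?exprS; [field; exact: lt0r_neq0|lia].
have -> : (m * p ^+ e + m * (e%:R * q%:R * p ^+ e ^+ 2 / p) + m * (m * p ^+ (2 * e)))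
    / (m * p ^+ e) ^+ 2 - 1 = m^-1 * (p ^+ e)^-1 + m^-1 * (e%:R * q%:R / p).
  by rewrite pee; field; rewrite !lt0r_neq0.
(* Regularity leaves more than half of the [q ^ e] cells in [Q]. *)
have mq : m^-1 <= 2 / q%:R ^+ e.
  rewrite -[leRHS]invrK invfM invrK lef_pV2 ?posrE ?mulr_gt0 ?exprn_gt0 ?invr_gt0 ?ltr0n//.
  rewrite mulrC ler_pdivrMr// -natrX -natrM ler_nat muln2.
  exact: ltnW.
rewrite [(q%:R * p) ^+ e]exprMn; apply: lerD.
  by rewrite [(q%:R ^+ e * _)^-1]invfM [2 * _]mulrA ler_wpM2r ?invr_ge0 ?(ltW pe0).
apply: le_trans (ler_wpM2r _ mq) _.
  by apply: divr_ge0; [rewrite mulr_ge0 ?ler0n | exact: ltW].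
by rewrite le_eqVlt; apply/orP; left; apply/eqP; field; rewrite ?expf_neq0 ?lt0r_neq0 ?ltr0n.
Qed.

(** Union bound over at most [n ^ (k * e)] boxes and, in each, at most [2 ^ (q ^ e)] sets [Q] of at
    least half of the cells. All values in the cells of [Q] are high with probability at most
    [2 ^ (- 16 #|Q|) <= 2 ^ (- 8 q ^ e)]. *)
Lemma avg_irregular : (1 - p) ^+ (b ^ e) <= 2^-1 ^+ 16 ->
  avg (fun f => (irregular f)%:R) <= (n ^ (k * e))%:R / 2 ^+ (7 * q ^ e) :> R.
Proof.
move=> pb.
pose high : {set 'I_N} := ~: low.
have card_high : #|high|%:R / #|'I_N|%:R = 1 - p :> R.
  have -> : #|high| = (N - X)%N.
    by rewrite -card_low -(addKn #|low| #|high|) cardsC card_ord.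
  by rewrite card_ord natrB// mulrBl mulfV// pnatr_eq0 -lt0n.
have T0 : (0 < #|'I_N|)%N by rewrite card_ord.
pose full B := [forall r, #|B r| == k].
pose pts B (Q : {set cell}) : {set 'I_e.+1 * sub_index e.+1 n} :=
  [set (ord0, point i0 B u.1 u.2) | u in finset.setX Q [set: {ffun 'I_e -> 'I_b}]%SET].
have card_pts B Q : full B -> #|pts B Q| = (#|Q| * b ^ e)%N.
  move=> /forallP Bk; rewrite card_imset.
    by rewrite cardsX cardsT card_ffun !card_ord.
  move=> [c o] [c' u] /(congr1 snd)/= /ffunP E.
  have {}E r : c r = c' r /\ o r = u r by apply: (point_inj qbk (eqP (Bk r)) (E r)).
  by congr (_, _); apply/ffunP => r; case: (E r).
pose big (Q : {set cell}) := (q ^ e <= (#|Q|).*2)%N.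
have half_bound Q : big Q -> (1 - p) ^+ (#|Q| * b ^ e) <= 2^-1 ^+ (8 * q ^ e).
  move=> bigQ; rewrite mulnC exprM.
  apply: (@le_trans _ _ (2^-1 ^+ 16 ^+ #|Q|)).
    by rewrite lerXn2r// nnegrE ?exprn_ge0 ?subr_ge0.
  rewrite -exprM; apply: ler_wiXn2l; rewrite ?invr_ge0 ?ler0n//.
    by rewrite invf_le1// ler1n.
  by move: bigQ; rewrite /big; lia.
have boxE B : full B -> avg (fun f => (q ^ e <= (#|[set c | empty_cell B f c]|).*2)%N%:R)
    <= 2^-1 ^+ (7 * q ^ e) :> R.
  move=> fB.
  apply: (@le_trans _ _ (avg (fun f => [exists Q, big Q && [forall u in pts B Q, f u \in high]]%:R))).
    apply: ler_avg => f; rewrite ler_nat; case: (boolP (q ^ e <= _)%N) => // emp.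
    suff -> : [exists Q, big Q && [forall u in pts B Q, f u \in high]] by [].
    apply/existsP; exists [set c | empty_cell B f c]%SET.
    rewrite /big emp; apply/forall_inP => u /imsetP[[c o]].
    rewrite !inE/= andbT => /forallP ec ->; rewrite -leqNgt; exact: ec.
  apply: le_trans (avg_exists _ big (fun Q f => [forall u in pts B Q, f u \in high])) _.
  apply: (@le_trans _ _ (\sum_(Q : {set cell}) 2^-1 ^+ (8 * q ^ e))).
    rewrite [leRHS](bigID big)/= -[leLHS]addr0; apply: lerD.
      apply: ler_sum => Q bigQ; rewrite avg_forall_in// card_high card_pts//.
      exact: half_bound.
    by apply: sumr_ge0 => Q _; rewrite exprn_ge0// invr_ge0 ler0n.
  rewrite sumr_const -[_ *+ _]mulr_natl.
  have -> : #|{: {set cell}}| = (2 ^ (q ^ e))%N.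
    have -> : #|{: {set cell}}| = (2 ^ #|{: cell}|)%N.
      rewrite -[#|{: cell}|]cardsT -card_powerset; apply: eq_card => Q.
      by rewrite !inE finset.subsetT.
    by rewrite card_ffun !card_ord.
  rewrite natrX (_ : 8 * q ^ e = q ^ e + 7 * q ^ e)%N; last by lia.
  by rewrite exprD mulrA -exprMn mulfV ?expr1n ?mul1r.
apply: le_trans (avg_exists _ full (fun B f => q ^ e <= (#|[set c | empty_cell B f c]|).*2)%N) _.
apply: le_trans (ler_sum _ boxE) _.
rewrite sumr_const -[_ *+ _]mulr_natl -exprVn ler_wpM2r ?exprn_ge0 ?invr_ge0 ?ler0n//.
rewrite ler_nat expnM.
pose S : {set {set 'I_n}} := [set A : {set 'I_n} | #|A| == k]%SET.
have -> : #|full| = (#|S| ^ #|'I_e|)%N.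
  rewrite -card_ffun_on; apply: eq_card => B.
  by apply/forallP/ffun_onP => H r; have := H r; rewrite inE.
rewrite card_draws !card_ord.
by case: (e) => // e'; rewrite leq_exp2r// bin_leq_exp.
Qed.

End Regularity.

(** * The greedy algorithm on rounded weights *)

Section GridGreedy.
Variables (R : realType) (e n N : nat).
Notation index := (sub_index e.+1 n).
Notation box := {ffun 'I_e -> {set 'I_n}}.
Notation env := {ffun 'I_e.+1 * index -> 'I_N}.
Implicit Types (B : box) (f g : env) (i : 'I_n) (j : index).

Definition grid_weight i j f : nat := (\sum_(l < e.+1) f (entry i j l))%N.

Definition grid_argmin i B f : option index :=
  [pick j : index | [forall r, j r \in B r] &&
    [forall j' : index, [forall r, j' r \in B r] ==> (grid_weight i j f <= grid_weight i j' f)%N]].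

(** The box before round [t] of greedy run on the rounded weights. The default of keeping [B] is not
    reached for [t <= n], as no side is empty before round [n]. *)
Fixpoint grid_box f (t : nat) : box :=
  if t is t'.+1 then
    let B := grid_box f t' in
    if obind (fun i => grid_argmin i B f) (insub t') is Some j then [ffun r => (B r :\ j r)%SET]
    else B
  else [ffun=> [set: 'I_n]%SET].

(** The box depends only on variables of earlier rows, so resampling [row_entries] of the current
    row leaves it unchanged. *)
Lemma eq_grid_box f g t :
  (forall i j l, (i < t)%N -> f (entry i j l) = g (entry i j l)) ->
  grid_box f t = grid_box g t.
Proof.
elim: t => //= t IH fg; rewrite IH; last by move=> i j l it; apply: fg; exact: ltnW.
case: insubP => //= i _ it.
have -> // : grid_argmin i (grid_box g t) f = grid_argmin i (grid_box g t) g.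
have E j : grid_weight i j f = grid_weight i j g.
  by apply: eq_bigr => l _; rewrite fg// it.
apply: eq_pick => j /=; congr (_ && _); apply: eq_forallb => j'.
by rewrite !E.
Qed.

Lemma grid_argmin_some i B f : (forall r, (0 < #|B r|)%N) ->
  exists2 j, grid_argmin i B f = Some j & forall r, j r \in B r.
Proof.
move=> B0; rewrite /grid_argmin; case: pickP => [j /andP[/forallP jB _]|no]; first by exists j.
have [j0 j0B] : exists j : index, [forall r, j r \in B r].
  have ch r : exists v, v \in B r by apply/finset.set0Pn; rewrite -card_gt0.
  exists [ffun r => xchoose (ch r)]; apply/forallP => r; rewrite ffunE; exact: xchooseP.
have [j jB jmin] := @arg_minnP _ j0 (fun j : index => [forall r, j r \in B r]) (grid_weight i ^~ f) j0B.
by have := no j; rewrite jB/=; case/negP; apply/forall_inP => j' /jmin.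
Qed.

Lemma card_grid_box f t r : (t <= n)%N -> #|grid_box f t r| = (n - t)%N.
Proof.
elim: t r => [r _|t IH r tn]; first by rewrite ffunE cardsT card_ord subn0.
rewrite /= insubT/=.
have B0 r' : (0 < #|grid_box f t r'|)%N by rewrite IH ?subn_gt0// ltnW.
have [j -> jB] := grid_argmin_some (Ordinal tn) f B0.
have := cardsD1 (j r) (grid_box f t r); rewrite jB IH ?(ltnW tn)//.
rewrite ffunE add1n => E.
by rewrite subnS E.
Qed.

(** Rounding [e.+1] summands down lowers [N] times a weight by less than [e.+1]. Outside this event
    the rounded weights therefore order each row as the true weights do. *)
Definition near_tie f :=
  [exists u : 'I_n * (index * index), (u.2.1 != u.2.2) &&
    ((grid_weight u.1 u.2.1 f < grid_weight u.1 u.2.2 f + e.+1)%N &&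
     (grid_weight u.1 u.2.2 f < grid_weight u.1 u.2.1 f + e.+1)%N)].

(** Induction on the run: without near ties, the choice of the run is the unique minimizer of the
    rounded weights in the current box. *)
Lemma greedy_run_box (W : multi_index e.+1 n -> R) f t B T :
  (forall i j, (grid_weight i j f)%:R <= N%:R * W (cons_index i j)
     < (grid_weight i j f + e.+1)%:R) ->
  ~~ near_tie f -> greedy_run W t B T -> B = grid_box f t.
Proof.
move=> Wf ntie; elim => {t B T} [//|i B T j _ -> jB jmin] /=.
rewrite valK/=; set B0 := grid_box f i in jB jmin *.
have sep j' : @in_box e.+1 n B0 j' -> j' != j -> (grid_weight i j f < grid_weight i j' f)%N.
  move=> j'B j'j; move: ntie; rewrite negb_exists => /forallP/(_ (i, (j', j))).
  rewrite j'j/= negb_and -!leqNgt.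
  have WW : (grid_weight i j f < grid_weight i j' f + e.+1)%N.
    rewrite -(ltr_nat R); have /andP[H1 _] := Wf i j; have /andP[_ H2] := Wf i j'.
    apply: le_lt_trans H1 _; apply: le_lt_trans H2.
    by rewrite ler_wpM2l ?ler0n// jmin.
  lia.
rewrite /grid_argmin; case: pickP => [j' /andP[/forallP j'B /forallP j'min]|].
  have [->//|/(sep _ j'B)] := eqVneq j' j.
  have := j'min j; rewrite (_ : [forall r, _]) ?implyTb; last by apply/forallP.
  lia.
move=> /(_ j)/negP[]; apply/andP; split; first exact/forallP.
apply/forall_inP => j' /forallP j'B.
by have [->//|/(sep _ j'B)/ltnW] := eqVneq j' j.
Qed.

Lemma avg_near_tie : (0 < N)%N ->
  avg (fun f => (near_tie f)%:R) <= (n ^ (2 * e).+1 * (2 * e.+1).+1)%:R / N%:R :> R.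
Proof.
move=> N0.
apply: le_trans (avg_exists _ (fun u : 'I_n * (index * index) => u.2.1 != u.2.2)
  (fun u f => (grid_weight u.1 u.2.1 f < grid_weight u.1 u.2.2 f + e.+1)%N &&
     (grid_weight u.1 u.2.2 f < grid_weight u.1 u.2.1 f + e.+1)%N)) _.
apply: (@le_trans _ _ (\sum_(u : 'I_n * (index * index)) (2 * e.+1).+1%:R / N%:R)); last first.
  rewrite sumr_const !card_prod !card_ffun !card_ord/=.
  by rewrite -[_ *+ _]mulr_natl mulrA -natrM -expnD addnn -mul2n -expnS.
rewrite [leLHS]big_mkcond; apply: ler_sum => -[i [j j']] _ /=; case: ifPn => // jj'.
(* All variables but [(ord0, j)] are frozen. It enters the weight of [j] and not that of [j'], so a
   near tie confines it to the window [V]. *)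
rewrite (avg_resample [set (ord0, j)]%SET); apply: ler_avg_cst => // f.
pose a := (\sum_(l < e) f (entry i j (lift ord0 l)))%N.
pose c := grid_weight i j' f.
pose V : {set 'I_N} := [set v : 'I_N | (v + a < c + e.+1)%N && (c < v + a + e.+1)%N].
have cardV : (#|V| <= (2 * e.+1).+1)%N.
  rewrite -[leqRHS]card_ord.
  rewrite -(card_in_imset (f := fun v : 'I_N => inord (v + a + e.+1 - c) : 'I_(2 * e.+1).+1)).
    exact: max_card.
  move=> v w; rewrite !inE => /andP[v1 v2] /andP[w1 w2] /(congr1 val)/=.
  by rewrite !inordK; [move=> ?; apply/val_inj => /=; lia|lia|lia].
apply: (@le_trans _ _ ((#|V|%:R / #|'I_N|%:R) ^+ #|[set (ord0, j) : 'I_e.+1 * index]%SET|)).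
  rewrite -avg_forall_in ?card_ord//; apply: ler_avg => h; rewrite ler_nat.
  have -> : grid_weight i j (resample [set (ord0, j)]%SET f h) = (h (ord0, j) + a)%N.
    rewrite /grid_weight big_ord_recl entry0 ffunE finset.in_set1 eqxx; congr addn.
    by apply: eq_bigr => l _; rewrite ffunE finset.in_set1 [_ == _]andbC andbF.
  have -> : grid_weight i j' (resample [set (ord0, j)]%SET f h) = c.
    apply: eq_bigr => l _; rewrite ffunE finset.in_set1; case: (unliftP ord0 l) => [l'|] ->.
      by [].
    by rewrite entry0 xpair_eqE eq_sym (negbTE jj') andbF.
  case: andP => // -[H1 H2].
  suff -> : [forall u in [set (ord0, j)]%SET, h u \in V] by [].
  by apply/forall_inP => u; rewrite finset.in_set1 => /eqP ->; rewrite inE H1 H2.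
rewrite cards1 expr1 card_ord ler_wpM2r ?invr_ge0 ?ler0n// ler_nat//.
Qed.

End GridGreedy.

(** * Numerical estimates *)

Section Numeric.

Lemma leq_exp2rW (a b c : nat) : (a <= b)%N -> (a ^ c <= b ^ c)%N.
Proof. by case: c => // c ab; rewrite leq_exp2r. Qed.

Lemma nat_root (m k : nat) : (0 < m)%N -> exists S, (S ^ m <= k < S.+1 ^ m)%N.
Proof.
move=> m0; elim: k => [|k [S /andP[lo hi]]]; first by exists 0%N; rewrite exp0n// exp1n.
have [hik|hik] := ltnP k.+1 (S.+1 ^ m); first by exists S; rewrite hik (leq_trans lo).
by exists S.+1; rewrite hik (leq_ltn_trans hi)// ltn_exp2r.
Qed.

(** With [v] the integer square root of [S], [2 S <= 2 ^ (1 + 2 v)], and [(1 + 2 v) C <= v ^ 2 <= S]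
    once [3 C <= v]. *)
Lemma exp_beats_poly (C : nat) :
  exists S0, forall S, (S0 <= S)%N -> ((2 * S) ^ C <= 2 ^ S)%N.
Proof.
exists ((3 * C).+1 ^ 2)%N => S S0S.
have [v /andP[vS Sv]] := nat_root S (isT : 0 < 2)%N.
have Cv : (3 * C < v.+1)%N.
  by rewrite -(ltn_exp2r _ _ (isT : 0 < 2)%N); apply: leq_ltn_trans Sv; apply: leq_trans S0S; rewrite leq_exp2r.
have v2 : (v.+1 <= 2 ^ v)%N by rewrite ltn_expl.
apply: (@leq_trans ((2 ^ (1 + v * 2)) ^ C)).
  apply: leq_exp2rW; rewrite expnD expn1 leq_mul2l expnM /=.
  by apply: ltnW; apply: leq_trans Sv _; rewrite leq_exp2r.
rewrite -expnM leq_exp2l//; apply: leq_trans vS.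
rewrite -mulnn; nia.
Qed.

(** As [n <= k ^ e.+2] and [k < (2 S) ^ e.+1], the left side is at most
    [(2 S) ^ (e.+1 * e.+2 * e.+2 * k)]. Its power [(8 S) ^ e] is at most
    [2 ^ (k * S ^ e.+1) <= 2 ^ (k ^ e)], and [k <= 8 S q]. The [+ 2] leaves a factor [n ^ -2] in the
    probability of irregularity. *)
Lemma union_bound_exponent (e n k S s : nat) : (2 <= e)%N ->
  ((2 * S) ^ (e.+1 * e.+2 * e.+2 * 8 ^ e) <= 2 ^ S)%N ->
  (0 < n)%N -> (4 <= S)%N -> (S ^ e.+1 <= k)%N -> (k < S.+1 ^ e.+1)%N -> (n <= k ^ e.+2)%N ->
  (0 < s <= S)%N -> (n ^ (k * e + 2) <= 2 ^ (7 * (k %/ (4 * s)) ^ e))%N.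
Proof.
move=> e2 HS n0 S4 Sk kS nk /andP[s0 sS]; set q := (k %/ (4 * s))%N.
have S2k : (4 * S <= k)%N.
  apply: leq_trans Sk; apply: (@leq_trans (S ^ 2)); last by rewrite leq_pexp2l//; lia.
  by rewrite -mulnn leq_mul2r S4 orbT.
have k0 : (0 < k)%N by lia.
have q0 : (0 < q)%N by rewrite divn_gt0; lia.
have kq : (k <= 8 * S * q)%N.
  have := ltn_ceil k (_ : 0 < 4 * s)%N; rewrite -/q => /(_ ltac:(lia)); nia.
have S20 : (0 < 2 * S)%N by lia.
apply: (@leq_trans (((2 * S) ^ (e.+1 * e.+2 * e.+2)) ^ k)).
  apply: (@leq_trans (((2 * S) ^ (e.+1 * e.+2)) ^ (k * e + 2))).
    apply: leq_exp2rW; apply: (leq_trans nk); rewrite expnM; apply: leq_exp2rW.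
    apply: (leq_trans (ltnW kS)); apply: leq_exp2rW; lia.
  by rewrite -!expnM leq_pexp2l// -!mulnA !leq_mul2l; apply/orP; right; apply/orP; right; nia.
apply: (@leq_trans (2 ^ (q ^ e))); last by rewrite leq_exp2l//; lia.
have S8 : (0 < (8 * S) ^ e)%N by rewrite expn_gt0; lia.
rewrite -(leq_exp2r _ _ S8).
apply: (@leq_trans ((2 ^ S) ^ (k * S ^ e))).
  apply: leq_trans (leq_exp2rW _ HS); rewrite -!expnM leq_pexp2l// expnMn.
  by rewrite -!mulnA !leq_mul2l; do !(apply/orP; right); rewrite mulnCA.
rewrite -!expnM leq_exp2l// -expnMn.
have -> : (S * (k * S ^ e) = k * S ^ e.+1)%N by rewrite expnS mulnCA.
apply: (@leq_trans (k ^ 2)); first by rewrite -mulnn leq_mul2l Sk orbT.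
apply: (@leq_trans (k ^ e)); first by rewrite leq_pexp2l.
by apply: leq_exp2rW; rewrite mulnC.
Qed.

Variable R : realFieldType.
Implicit Types (a x : R).

(** [(1 + x) ^ m >= 2] by Bernoulli's inequality with [x = 1 / m], and [(1 - x) (1 + x) <= 1]. *)
Lemma bernoulli_half (m : nat) : (0 < m)%N -> (1 - m%:R^-1) ^+ m <= 2^-1 :> R.
Proof.
move=> m0; set x : R := m%:R^-1.
have x0 : 0 < x by rewrite invr_gt0 ltr0n.
have x1 : x <= 1 by rewrite invf_le1 ?ltr0n// ler1n.
have B u : 1 + u%:R * x <= (1 + x) ^+ u.
  elim: u => [|u IH]; first by rewrite mul0r addr0 expr0.
  rewrite exprS; apply: le_trans (ler_wpM2l _ IH); last by lra.
  rewrite -natr1; have : 0 <= u%:R * x * x by rewrite !mulr_ge0 ?ler0n ?ltW.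
  nra.
have := B m; rewrite mulfV ?pnatr_eq0 -?lt0n// => H.
rewrite -[leRHS]mul1r ler_pdivlMr//; apply: le_trans (ler_wpM2l _ H) _.
  by rewrite exprn_ge0// subr_ge0.
rewrite -exprMn; apply: exprn_ile1; nra.
Qed.

Lemma subrX_le (m : nat) (a b : R) : 0 <= a -> a <= b ->
  b ^+ m - a ^+ m <= m%:R * (b - a) * b ^+ m.-1.
Proof.
move=> a0 ab; case: m => [|m]; first by rewrite subrr !mul0r.
elim: m => [|m IH]; first by rewrite !expr1 expr0 mul1r mulr1.
have b0 : 0 <= b by exact: le_trans ab.
have am : a ^+ m.+1 <= b ^+ m.+1 by rewrite lerXn2r.
rewrite /= in IH *.
have -> : b ^+ m.+2 - a ^+ m.+2 = b * (b ^+ m.+1 - a ^+ m.+1) + (b - a) * a ^+ m.+1.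
  by rewrite !(exprS _ m.+1); ring.
apply: (@le_trans _ _ (b * (m.+1%:R * (b - a) * b ^+ m) + (b - a) * b ^+ m.+1)).
  by rewrite lerD// ler_wpM2l// subr_ge0.
by rewrite -[m.+2]addn1 natrD exprS le_eqVlt; apply/orP; left; apply/eqP; ring.
Qed.

(** Mean value bound on [[s - 1, s]]; the factor [2 ^ e] comes from [s - 1 >= s / 2]. *)
Lemma level_gap (e s : nat) : (2 <= s)%N ->
  s.-1%:R ^- e - s%:R ^- e <= e%:R * 2 ^+ e / s%:R ^+ e.+1 :> R.
Proof.
move=> s2; set a : R := s.-1%:R; set b : R := s%:R.
have ab : b = a + 1 by rewrite /a /b natr1; congr _%:R; lia.
have a1 : 1 <= a by rewrite /a ler1n; lia.
have a0 : 0 < a by lra.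
have b0 : 0 < b by lra.
have ae : 0 < a ^+ e by exact: exprn_gt0.
have be : 0 < b ^+ e by exact: exprn_gt0.
have -> : a ^- e - b ^- e = (b ^+ e - a ^+ e) / b ^+ e * a ^- e.
  by field; rewrite !lt0r_neq0.
have H1 : (b ^+ e - a ^+ e) / b ^+ e <= e%:R / b.
  rewrite ler_pdivrMr//; apply: le_trans (subrX_le _ _ _) _; [lra|lra|].
  have -> : b - a = 1 by rewrite ab; ring.
  rewrite mulr1; case: (e) => [|e']; first by rewrite !mul0r.
  by rewrite exprS mulrA mulfVK// lt0r_neq0.
have H2 : a ^- e <= 2 ^+ e / b ^+ e.
  rewrite -[leRHS]invrK invf_div lef_pV2 ?posrE ?divr_gt0 ?exprn_gt0//.
  by rewrite -expr_div_n lerXn2r ?nnegrE ?divr_ge0 ?(ltW a0) ?(ltW b0)//; lra.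
apply: (@le_trans _ _ (e%:R / b * (2 ^+ e / b ^+ e))).
  apply: ler_pM => //; last by rewrite invr_ge0 ltW.
  by rewrite divr_ge0 ?(ltW be)// subr_ge0 lerXn2r ?nnegrE ?(ltW a0) ?(ltW b0)//; lra.
by rewrite exprS invfM le_eqVlt; apply/orP; left; apply/eqP; ring.
Qed.

(** Induction on [S]: a missed scale adds the gap that leads back from [x S] to [x S.-1]; at a scale
    not missed, [x S] alone bounds [c] and the other terms are nonnegative. The unconditional bound
    at scale 1 starts the induction. *)
Lemma level_sum (S : nat) (x : nat -> R) (m : nat -> bool) (c : R) :
  (forall s, (1 < s)%N -> x s <= x s.-1) -> (0 < S)%N -> c <= x 1%N ->
  (forall s, (1 < s <= S)%N -> ~~ m s -> c <= x s) ->
  c <= x S + \sum_(2 <= s < S.+1) (x s.-1 - x s) * (m s)%:R.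
Proof.
move=> xmono; elim: S => // -[|S] IH _ c1 cx.
  by rewrite big_geq// addr0.
rewrite big_nat_recr//=; have [mS|/(cx S.+2 (leqnn _)) cS] := boolP (m S.+2).
  have : c <= x S.+1 + \sum_(2 <= s < S.+2) (x s.-1 - x s) * (m s)%:R.
    by apply: IH => // s /andP[s1 sS]; apply: cx; rewrite s1/=; exact: leqW.
  by rewrite /= mulr1; lra.
rewrite mulr0 addr0; apply: (le_trans cS); rewrite lerDl big_seq.
apply: sumr_ge0 => s; rewrite mem_index_iota => /andP[s1 _].
by rewrite mulr_ge0 ?ler0n// subr_ge0 xmono.
Qed.

End Numeric.

(** * Mean of the minimum in one greedy round *)

Section RowBound.
Variables (R : realType) (e n N : nat).
Hypotheses (e2 : (2 <= e)%N) (N0 : (0 < N)%N).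
Notation index := (sub_index e.+1 n).
Notation env := {ffun 'I_e.+1 * index -> 'I_N}.
Implicit Types (f : env) (i : 'I_n).

Lemma threshold_ratio s : (0 < s)%N -> (s ^ e %| N)%N ->
  (N %/ s ^ e)%:R / N%:R = s%:R ^- e :> R.
Proof.
move=> s0 /dvdnP[M NE]; have se0 : (0 < s ^ e)%N by rewrite expn_gt0 s0.
have M0 : (0 < M)%N by move: N0; rewrite NE; case: (M).
rewrite NE mulnK// natrM natrX invfM mulrA mulfV ?mul1r//.
by rewrite pnatr_eq0 -lt0n.
Qed.

(** Resampling the fresh variables of row [i] keeps the box fixed. The inner average is bounded by
    [avg_miss_regular] for regular [f] and by 1 otherwise, which adds the probability of
    irregularity. *)
Lemma avg_miss_grid i s q : q = ((n - i) %/ (4 * s))%N ->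
  (0 < s)%N -> (s ^ e %| N)%N -> (4 * s <= n - i)%N ->
  avg (fun f => (miss (N %/ s ^ e) i (grid_box f i) f)%:R) <=
  (n ^ ((n - i) * e))%:R / 2 ^+ (7 * q ^ e)
    + (2 / (q%:R / s%:R ^+ e) ^+ e + 2 * e%:R * q%:R / (q%:R ^+ e / s%:R ^+ e)) :> R.
Proof.
move=> qE s0 sN sk; set k := (n - i)%N; set X := (N %/ s ^ e)%N.
have e0 : (0 < e)%N by lia.
have qbk : (q * (4 * s) <= k)%N by rewrite qE leq_divM.
have b0 : (0 < 4 * s)%N by lia.
have q0 : (0 < q)%N by rewrite qE divn_gt0.
have X0 : (0 < X)%N by rewrite divn_gt0 ?expn_gt0 ?s0// dvdn_leq.
have XN : (X <= N)%N by exact: leq_div.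
have pE : X%:R / N%:R = s%:R ^- e :> R by exact: threshold_ratio.
pose irr f := irregular k q (4 * s) X i f.
rewrite (avg_resample (row_entries i)).
apply: (@le_trans _ _ (avg (fun f => (irr f)%:R +
    (2 / (q%:R / s%:R ^+ e) ^+ e + 2 * e%:R * q%:R / (q%:R ^+ e / s%:R ^+ e))))).
  apply: ler_avg => f.
  have ratio0 : 0 <= 2 / (q%:R / s%:R ^+ e) ^+ e + 2 * e%:R * q%:R / (q%:R ^+ e / s%:R ^+ e) :> R.
    by rewrite addr_ge0// ?divr_ge0 ?mulr_ge0 ?exprn_ge0 ?divr_ge0 ?exprn_ge0 ?ler0n.
  have [irrf|regf] := boolP (irr f).
    apply: ler_avg_cst => [|h]; first by rewrite addr_ge0.
    by apply: le_trans (_ : 1 <= _); [rewrite lern1; case: (miss _ _ _ _)|rewrite lerDl].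
  rewrite add0r.
  have Bk r : #|grid_box f i r| = k by rewrite card_grid_box// ltnW.
  have := avg_miss_regular R qbk b0 q0 N0 X0 XN i Bk regf.
  rewrite pE; apply: le_trans; apply: ler_avg => h.
  rewrite (@eq_grid_box _ _ _ (resample (row_entries i) f h) f)// => i' j l i'i.
  rewrite ffunE (negbTE (entry_notin_row _ _ _ _))//.
  by apply: contraTneq i'i => ->; rewrite ltnn.
rewrite avgD avg_cst; last by rewrite card_ffun card_ord expn_gt0 N0.
rewrite lerD2r; apply: avg_irregular => //.
(* A subcube of side [4 s] holds [4 ^ e >= 16] groups of [s ^ e] points, each entirely high with
   probability at most 1/2. *)
rewrite pE expnMn mulnC exprM.
have se0 : (0 < s ^ e)%N by rewrite expn_gt0 s0.
have := bernoulli_half R se0; rewrite natrX => H.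
apply: (@le_trans _ _ (2^-1 ^+ (4 ^ e))).
  by rewrite lerXn2r// nnegrE ?exprn_ge0 ?subr_ge0 ?invr_ge0// invf_le1 ?exprn_gt0 ?ltr0n// exprn_ege1// ler1n.
apply: ler_wiXn2l; rewrite ?invr_ge0// ?invf_le1 ?ler1n//.
by rewrite (@leq_exp2l 4 2 e).
Qed.

(* The scale [s] misses when the box has no entry whose summands are all below
   [s^-e]; the minimum is then charged to the largest scale that does not. *)
Definition row_bound i (S : nat) f : R :=
  e.+1%:R * (S%:R ^- e + \sum_(2 <= s < S.+1)
    (s.-1%:R ^- e - s%:R ^- e) * (miss (N %/ s ^ e) i (grid_box f i) f)%:R).

(** The factors come from [level_gap], from the two second moment terms, and from [k <= 8 s q]. *)
Definition level_cst : R := e%:R * 2 ^+ e * (2 + 2 * e%:R) * 8 ^+ e.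

(** The first term uses [k ^ e.-1 >= s ^ (e ^ 2 - 1)], the second [q ^ 2 <= q ^ e]; both then use
    [k <= 8 s q]. *)
Lemma level_ratio (k q s : nat) : (0 < s)%N -> (0 < q)%N -> (s ^ e.+1 <= k)%N ->
  (k <= 8 * s * q)%N ->
  e%:R * 2 ^+ e / s%:R ^+ e.+1 *
    (2 / (q%:R / s%:R ^+ e) ^+ e + 2 * e%:R * q%:R / (q%:R ^+ e / s%:R ^+ e))
  <= level_cst / k%:R.
Proof.
move=> s0 q0 sk kq.
have k0 : (0 < k)%N by apply: leq_trans sk; rewrite expn_gt0 s0.
have natA : (k * (s ^ e) ^ e <= 8 ^ e * (q ^ e * s ^ e.+1))%N.
  apply: (@leq_trans (k ^ e * s)).
    rewrite -[X in (_ <= X ^ _ * _)%N]/k -[in leqRHS](prednK (ltnW e2)) expnS -mulnA leq_mul2l.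
    apply/orP; right; apply: leq_trans (leq_mul (leq_exp2rW e.-1 sk) (leqnn s)).
    by rewrite -!expnM -expnSr leq_pexp2l//; nia.
  rewrite expnS [(s * _)%N]mulnC !mulnA leq_mul2r -!expnMn; apply/orP; right.
  by apply: leq_exp2rW; apply: leq_trans kq _; nia.
have natB : (k * q <= 8 ^ e * (q ^ e * s))%N.
  apply: (@leq_trans (8 * s * q * q)); first by rewrite leq_mul2r kq orbT.
  have q2 : (q * q <= q ^ e)%N by rewrite mulnn leq_pexp2l.
  have e8 : (8 <= 8 ^ e)%N by rewrite -[leqLHS]expn1 leq_pexp2l//; lia.
  have := leq_mul e8 q2; nia.
have s0R : 0 < s%:R :> R by rewrite ltr0n.
have q0R : 0 < q%:R :> R by rewrite ltr0n.
have k0R : 0 < k%:R :> R by rewrite ltr0n.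
have P (x : R) m : 0 < x -> 0 < x ^+ m by exact: exprn_gt0.
have A : (s%:R ^+ e) ^+ e / (q%:R ^+ e * s%:R ^+ e.+1) <= 8 ^+ e / k%:R :> R.
  rewrite ler_pdivrMr ?mulr_gt0 ?P// mulrAC ler_pdivlMr// mulrC.
  by move: natA; rewrite -(ler_nat R) !natrM !natrX.
have B : q%:R / (q%:R ^+ e * s%:R) <= 8 ^+ e / k%:R :> R.
  rewrite ler_pdivrMr ?mulr_gt0 ?P// mulrAC ler_pdivlMr// mulrC.
  by move: natB; rewrite -(ler_nat R) !natrM !natrX.
have -> : e%:R * 2 ^+ e / s%:R ^+ e.+1 *
    (2 / (q%:R / s%:R ^+ e) ^+ e + 2 * e%:R * q%:R / (q%:R ^+ e / s%:R ^+ e)) =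
   e%:R * 2 ^+ e * (2 * ((s%:R ^+ e) ^+ e / (q%:R ^+ e * s%:R ^+ e.+1)) +
     2 * e%:R * (q%:R / (q%:R ^+ e * s%:R))) :> R.
  rewrite expr_div_n exprS; have := P _ e s0R; move: (_ ^+ e) => u u0.
  by have := P _ e u0; have := P _ e q0R => ? ?; field; rewrite !lt0r_neq0.
rewrite /level_cst -[leRHS]mulrA -!(mulrA (e%:R * _)) ler_wpM2l ?mulr_ge0 ?exprn_ge0 ?ler0n//.
rewrite [leRHS]mulrDl lerD//; first by rewrite ler_wpM2l.
by rewrite ler_wpM2l// mulr_ge0 ?ler0n.
Qed.

(** At most [S] scales contribute [level_cst / k] each, and [S / k <= S ^ -e]. Irregularity adds at
    most [e * 2 ^ e / n ^ 2] per scale, and [S <= n]. *)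
Lemma avg_row_bound i (S : nat) : let k := (n - i)%N in
  (forall s, (0 < s <= n)%N -> (s ^ e %| N)%N) ->
  ((2 * S) ^ (e.+1 * e.+2 * e.+2 * 8 ^ e) <= 2 ^ S)%N -> (4 <= S)%N ->
  (S ^ e.+1 <= k)%N -> (k < S.+1 ^ e.+1)%N -> (n <= k ^ e.+2)%N ->
  avg (row_bound i S) <=
  e.+1%:R * ((1 + level_cst) * S%:R ^- e + e%:R * 2 ^+ e / n%:R).
Proof.
move=> k sN HS S4 Sk kS nk.
have n0 : (0 < n)%N by exact: leq_ltn_trans (ltn_ord i).
have [f0|T0] := posnP #|{: env}|; first by move: f0; rewrite card_ffun card_ord => /eqP; rewrite expn_eq0 gtn_eqF.
have kn : (k <= n)%N by exact: leq_subr.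
have SSk : (S * S <= k)%N.
  by apply: leq_trans Sk; rewrite mulnn leq_pexp2l//; lia.
have k0 : (0 < k)%N by nia.
have n0R : 0 < n%:R :> R by rewrite ltr0n.
have S0R : 0 < S%:R :> R by rewrite ltr0n; lia.
have k0R : 0 < k%:R :> R by rewrite ltr0n.
have c0 : 0 <= level_cst by rewrite /level_cst !mulr_ge0 ?addr_ge0 ?exprn_ge0 ?mulr_ge0 ?ler0n.
rewrite /row_bound avgZ ler_wpM2l ?ler0n// avgD avg_cst// avg_sum mulrDl mul1r -addrA lerD2l.
apply: (@le_trans _ _ (\sum_(2 <= s < S.+1) (e%:R * 2 ^+ e / n%:R ^+ 2 + level_cst / k%:R))).
  rewrite big_seq [leRHS]big_seq; apply: ler_sum => s.
  rewrite mem_index_iota => /andP[s2 sS].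
  have s0 : (0 < s)%N by lia.
  have s0R : 0 < s%:R :> R by rewrite ltr0n.
  have sk : (4 * s <= k)%N by nia.
  have sn : (s <= n)%N by lia.
  set q := (k %/ (4 * s))%N.
  have q0 : (0 < q)%N by rewrite divn_gt0; lia.
  have kq : (k <= 8 * s * q)%N.
    have := ltn_ceil k (_ : 0 < 4 * s)%N; rewrite -/q => /(_ ltac:(lia)); nia.
  rewrite avgZ; apply: le_trans (ler_wpM2r _ (level_gap _ _ s2)) _.
    by rewrite divr_ge0 ?sumr_ge0// => f _; rewrite ler0n.
  have coef0 : 0 <= e%:R * 2 ^+ e / s%:R ^+ e.+1 :> R.
    by rewrite divr_ge0 ?mulr_ge0 ?exprn_ge0 ?ler0n.
  apply: le_trans (ler_wpM2l coef0 (avg_miss_grid (erefl q) _ _ _)) _ => //.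
    by apply: sN; lia.
  rewrite -/k -/q mulrDr lerD//; last first.
    by apply: level_ratio => //; apply: leq_trans Sk; apply: leq_exp2rW; lia.
  have U := union_bound_exponent e2 HS n0 S4 Sk kS nk (_ : 0 < s <= S)%N.
  have {U} : (n ^ (k * e + 2) <= 2 ^ (7 * q ^ e))%N by apply: U; lia.
  rewrite -(ler_nat R) expnD natrM [in leRHS]natrX [(n ^ 2)%:R]natrX => U.
  have s1 : e%:R * 2 ^+ e / s%:R ^+ e.+1 <= e%:R * 2 ^+ e :> R.
    rewrite ler_pdivrMr ?exprn_gt0// ler_peMr ?mulr_ge0 ?exprn_ge0 ?ler0n//.
    by rewrite exprn_ege1// ler1n.
  apply: ler_pM => //.
  by rewrite ler_pdivrMr ?exprn_gt0// mulrC ler_pdivlMr ?exprn_gt0.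
rewrite sumr_const_nat -[_ *+ _]mulr_natl.
apply: (@le_trans _ _ (S%:R * (e%:R * 2 ^+ e / n%:R ^+ 2 + level_cst / k%:R))).
  rewrite ler_wpM2r//; last by rewrite ler_nat; lia.
  by rewrite addr_ge0// ?divr_ge0 ?mulr_ge0 ?exprn_ge0 ?ler0n.
rewrite mulrDr addrC; apply: lerD; last first.
  have SkR : S%:R / k%:R <= S%:R ^- e :> R.
    rewrite -[leRHS]mul1r ler_pdivlMr ?exprn_gt0// mulrAC ler_pdivrMr// mul1r.
    by rewrite -exprS -natrX ler_nat.
  by rewrite mulrCA ler_wpM2l.
rewrite expr2 invfM mulrCA ler_wpM2l ?mulr_ge0 ?exprn_ge0 ?ler0n// mulrA ler_piMl ?invr_ge0 ?ler0n//.
by rewrite ler_pdivrMr// mul1r ler_nat; nia.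
Qed.

End RowBound.

(** * From counting to the probability space *)

Section GridTransfer.
Local Open Scope classical_set_scope.
Variables (R : realType) (dO : measure_display) (Omega : measurableType dO).
Variables (P : probability Omega R) (I : finType) (X : I -> {RV P >-> R}) (N : nat).
Hypotheses (X_indep : mutually_independent X) (X_unif : forall p, uniform01 (X p)).
Hypothesis N0 : (0 < N)%N.
Notation grid := {ffun I -> 'I_N}.
Implicit Types f : grid.

Definition grid_itv (v : nat) : set R := `[v%:R / N%:R, v.+1%:R / N%:R[.

Definition grid_cell f : set Omega := \bigcap_(p in [set` [set: I]%SET]) X p @^-1` grid_itv (f p).

Lemma grid_cellP f w : grid_cell f w -> forall p,
  (f p)%:R <= N%:R * X p w < (f p).+1%:R.
Proof.
move=> fw p; have := fw p (finset.in_setT p).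
rewrite /grid_itv/= in_itv/= ler_pdivrMr ?ltr0n// ltr_pdivlMr ?ltr0n//.
by rewrite mulrC.
Qed.

Lemma grid_itv_prob v : (v < N)%N -> uniform_prob (@ltr01 R) (grid_itv v) = (N%:R^-1)%:E.
Proof.
move=> vN; have N0R : 0 < N%:R :> R by rewrite ltr0n.
rewrite /uniform_prob integral_uniform_pdf.
have sub : grid_itv v `<=` `[0, 1].
  move=> x; rewrite /grid_itv/= !in_itv/= => /andP[x0 x1]; apply/andP; split.
    by apply: le_trans x0; rewrite divr_ge0.
  by apply: (le_trans (ltW x1)); rewrite ler_pdivrMr// mul1r ler_nat.
rewrite setIidl//.
rewrite (eq_integral (cst 1%:E)); last first.
  move=> x /[!inE] /sub/=; rewrite in_itv/= => x01.
  by rewrite /uniform_pdf x01 subr0 invr1.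
rewrite integral_cst; last exact: measurable_itv.
rewrite mul1e /grid_itv/= lebesgue_measure_itv/= lte_fin.
rewrite ltr_pM2r ?invr_gt0// ltr_nat ltnS leqnn -EFinD; congr _%:E.
by rewrite -mulrBl -natr1 addrAC subrr add0r mul1r.
Qed.

Lemma measurable_grid_cell f : measurable (grid_cell f).
Proof.
apply: fin_bigcap_measurable; first exact: finite_finset.
move=> p _; rewrite -[X in measurable X]setTI.
by apply: (measurable_funP (X p)) => //; exact: measurable_itv.
Qed.

Lemma prob_grid_cell f : P (grid_cell f) = (#|{: grid}|%:R^-1)%:E.
Proof.
rewrite /grid_cell (X_indep _ (E := fun p => grid_itv (f p))); last by move=> p; exact: measurable_itv.
rewrite (eq_bigr (fun=> (N%:R^-1)%:E)); last first.
  move=> p _; rewrite -(grid_itv_prob (ltn_ord (f p))); exact: X_unif (measurable_itv _).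
rewrite prodEFin prodr_const cardsT card_ffun card_ord.
by rewrite natrX exprVn.
Qed.

Lemma trivIset_grid_cell : trivIset [set: grid] grid_cell.
Proof.
move=> f g _ _ [w [fw gw]]; apply/ffunP => p; apply/val_inj => /=.
have /andP[f1 f2] := grid_cellP fw p; have /andP[g1 g2] := grid_cellP gw p.
have := le_lt_trans f1 g2; have := le_lt_trans g1 f2; rewrite !ltr_nat; lia.
Qed.

Let U := \bigcup_(f in [set: grid]) grid_cell f.

Let mU : measurable U.
Proof. by apply: fin_bigcup_measurable => // f _; exact: measurable_grid_cell. Qed.

Let sum_prob_grid_cell (F : grid -> R) :
  (\sum_f (F f)%:E * P (grid_cell f) = (avg F)%:E)%E.
Proof.
rewrite (eq_bigr (fun f => (F f / #|{: grid}|%:R)%:E)); last first.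
  by move=> f _; rewrite prob_grid_cell EFinM.
by rewrite sumEFin -mulr_suml.
Qed.

(** The half-open intervals omit the value 1 and everything outside [[0, 1]], but the equal
    probabilities of the disjoint cells add up to 1. *)
Let prob_U : P (~` U) = 0%E.
Proof.
have setTE : [set: grid] = [set` index_enum grid].
  by apply/seteqP; split => // f _ /=; rewrite mem_index_enum.
have grid0 : (0 < #|{: grid}|)%N by rewrite card_ffun card_ord expn_gt0 N0.
rewrite probability_setC//= /U measure_fin_bigcup//; last first.
- by move=> f _; exact: measurable_grid_cell.
- exact: trivIset_grid_cell.
- exact: finite_finset.
rewrite setTE -fsbig_seq ?index_enum_uniq//.
rewrite (eq_bigr (fun f => 1%:E * P (grid_cell f))%E); last by move=> f _; rewrite mul1e.
by rewrite (sum_prob_grid_cell (fun=> 1)) avg_cst// subee.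
Qed.

Let G (F : grid -> R) w : R := \sum_f F f * \1_(grid_cell f) w.

Let G_cell F f w : grid_cell f w -> G F w = F f.
Proof.
move=> fw; rewrite /G (bigD1 f)//= indicE mem_set// mulr1 big1 ?addr0// => g gf.
rewrite indicE memNset ?mulr0// => gw; case/eqP: gf.
by apply: trivIset_grid_cell => //; exists w.
Qed.

Let measurable_G F : measurable_fun setT (G F).
Proof.
apply: measurable_sum => f; apply: measurable_funM => //.
exact/measurable_indic/measurable_grid_cell.
Qed.

Let integral_G F : (forall f, 0 <= F f) -> (\int[P]_w (G F w)%:E = (avg F)%:E)%E.
Proof.
move=> F0; under eq_integral => w _ do rewrite /G -sumEFin.
rewrite ge0_integral_sum//; last first.
- by move=> f w _; rewrite lee_fin mulr_ge0// indicE ler0n.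
- move=> f; apply/measurable_EFinP; apply: measurable_funM => //.
  exact/measurable_indic/measurable_grid_cell.
rewrite -sum_prob_grid_cell; apply: eq_bigr => f _.
under eq_integral => w _ do rewrite EFinM.
rewrite ge0_integralZl_EFin//; last first.
  by apply/measurable_EFinP; exact/measurable_indic/measurable_grid_cell.
by rewrite integral_indic// ?setIT//; exact: measurable_grid_cell.
Qed.

Let expectation_U (Y : Omega -> R) : measurable_fun setT Y ->
  ('E_P[Y] = \int[P]_w (Y w * \1_U w)%:E)%E.
Proof.
move=> mY; rewrite unlock; apply: ae_eq_integral => //.
- exact/measurable_EFinP.
- apply/measurable_EFinP; apply: measurable_funM => //.
exists (~` U); split => //; first exact: measurableC.
move=> w /= nE Uw; apply: nE => _; by rewrite indicE mem_set// mulr1.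
Qed.

Lemma expectation_le_grid (Y : Omega -> R) (F : grid -> R) : measurable_fun setT Y ->
  (forall f, 0 <= F f) -> (forall f w, grid_cell f w -> 0 <= Y w <= F f) ->
  ('E_P[Y] <= (avg F)%:E)%E.
Proof.
move=> mY F0 YF; rewrite expectation_U// -integral_G//.
have G0 w : 0 <= G F w by apply: sumr_ge0 => f _; rewrite mulr_ge0// indicE ler0n.
apply: ge0_le_integral => //.
- move=> w _; rewrite lee_fin indicE; case: (boolP (w \in U)) => [|_]; last by rewrite mulr0.
  by rewrite inE => -[f _ /YF/andP[Y0 _]]; rewrite mulr1.
- apply/measurable_EFinP; apply: measurable_funM => //.
- exact/measurable_EFinP.
move=> w _; rewrite lee_fin indicE; case: (boolP (w \in U)) => [|_]; last by rewrite mulr0.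
by rewrite inE => -[f _ fw]; rewrite mulr1 (G_cell _ fw); case/andP: (YF _ _ fw).
Qed.

Lemma expectation_ge_grid (Y : Omega -> R) (F : grid -> R) : measurable_fun setT Y ->
  (forall f, 0 <= F f) -> (forall f w, grid_cell f w -> F f <= Y w) ->
  ((avg F)%:E <= 'E_P[Y])%E.
Proof.
move=> mY F0 YF; rewrite expectation_U// -integral_G//.
have G0 w : 0 <= G F w by apply: sumr_ge0 => f _; rewrite mulr_ge0// indicE ler0n.
apply: ge0_le_integral => //.
- by move=> w _; rewrite lee_fin.
- exact/measurable_EFinP.
- apply/measurable_EFinP; apply: measurable_funM => //.
move=> w _; rewrite lee_fin indicE; case: (boolP (w \in U)) => [|/negP nU].
  by rewrite inE => -[f _ fw]; rewrite mulr1 (G_cell _ fw) YF.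
rewrite mulr0 /G big1// => f _; rewrite indicE memNset ?mulr0// => fw.
by apply: nU; rewrite inE; exists f.
Qed.

End GridTransfer.

(** * Cost bounds in terms of the rounded weights *)

Section Discretized.
Variables (R : realType) (e n N : nat).
Hypothesis N0 : (0 < N)%N.
Notation index := (sub_index e.+1 n).
Notation env := {ffun 'I_e.+1 * index -> 'I_N}.
Implicit Types (f : env) (i : 'I_n) (j : index) (A : 'I_e.+1 -> index -> R).

Definition rounds f A :=
  forall l t, (f (l, t))%:R <= N%:R * A l t < (f (l, t)).+1%:R.

Let N0R : 0 < N%:R :> R. Proof. by rewrite ltr0n. Qed.

Lemma rounds_ge0 f A l t : rounds f A -> 0 <= A l t.
Proof.
move=> /(_ l t)/andP[+ _]; move=> /(le_trans (ler0n _ _)).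
by rewrite pmulr_rge0.
Qed.

Lemma weightE A i j : weight A (cons_index i j) = \sum_(l < e.+1) A l (entry i j l).2.
Proof. by []. Qed.

Lemma rounds_weight f A : rounds f A -> forall i j,
  (grid_weight i j f)%:R <= N%:R * weight A (cons_index i j)
    < (grid_weight i j f + e.+1)%:R.
Proof.
move=> fA i j; rewrite weightE mulr_sumr /grid_weight natr_sum; apply/andP; split.
  by apply: ler_sum => l _; case/andP: (fA l (entry i j l).2).
rewrite natrD natr_sum (_ : e.+1%:R = \sum_(l < e.+1) 1); last by rewrite sumr_const card_ord.
rewrite -big_split/=.
apply: ltr_sum => [|l _]; first by apply/hasP; exists ord0; rewrite ?mem_index_enum.
by rewrite natr1; case/andP: (fA l (entry i j l).2).
Qed.

Lemma weight_ge0 f A x : rounds f A -> 0 <= weight A x.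
Proof. by move=> fA; apply: sumr_ge0 => l _; exact: rounds_ge0 fA. Qed.

Lemma hit_weight f A X i j : rounds f A -> hit X i j f ->
  weight A (cons_index i j) <= e.+1%:R * (X%:R / N%:R).
Proof.
move=> fA /forallP fX; rewrite weightE -[e.+1 in leRHS]card_ord mulr_natl -sumr_const.
apply: ler_sum => l _; rewrite ler_pdivlMr// mulrC.
have /andP[_ /ltW/le_trans] := fA l (entry i j l).2; apply.
by rewrite ler_nat; exact: fX.
Qed.

Lemma weight_le f A i j : rounds f A -> weight A (cons_index i j) <= e.+1%:R.
Proof.
move=> fA; have := @hit_weight f A N i j fA; rewrite mulfV ?lt0r_neq0// mulr1; apply.
by apply/forallP.
Qed.

Lemma nhit_weight f A i j : rounds f A -> ~~ hit 1 i j f ->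
  N%:R^-1 <= weight A (cons_index i j).
Proof.
move=> fA; rewrite negb_forall => /existsP[l]; rewrite -leqNgt => fl.
rewrite weightE (bigD1 l)//= -[leLHS]addr0; apply: lerD; last first.
  by apply: sumr_ge0 => l' _; exact: rounds_ge0 fA.
rewrite -[leLHS]mul1r ler_pdivrMr// mulrC.
have /andP[H _] := fA l (entry i j l).2; apply: le_trans H.
by rewrite ler1n.
Qed.

Lemma avg_hit X i j : (X <= N)%N ->
  avg (fun f => (hit X i j f)%:R) = (X%:R / N%:R) ^+ e.+1 :> R.
Proof.
move=> XN; pose V : {set 'I_N} := [set v : 'I_N | (v < X)%N].
have cV : #|V| = X by exact: card_ord_lt.
pose U := [set entry i j l | l : 'I_e.+1].
have cU : #|U| = e.+1 by rewrite card_imset ?card_ord// => l l' /(congr1 fst).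
transitivity ((#|V|%:R / #|'I_N|%:R) ^+ #|U| : R); last by rewrite cV cU card_ord.
rewrite -avg_forall_in ?card_ord//.
apply: eq_avg => f; congr (nat_of_bool _)%:R.
apply/forallP/forall_inP => [H _ /imsetP[l _ ->]|H l]; first by rewrite inE.
by have := H _ (imset_f _ (isT : l \in 'I_e.+1)); rewrite inE.
Qed.

Lemma greedy_run_row (W : multi_index e.+1 n -> R) m B T :
  greedy_run W m B T -> forall i, (i < m)%N ->
  exists B' T' j, [/\ greedy_run W i B' T', in_box B' j,
    forall j', in_box B' j' -> W (cons_index i j) <= W (cons_index i j') &
    (i, j) \in T].
Proof.
elim => {m B T} [//|i0 B T j0 run IH j0B j0min] i; rewrite ltnS leq_eqVlt => /orP[/eqP/val_inj ->|].
  by exists B, T, j0; split => //; rewrite finset.setU11.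
move=> /IH[B' [T' [j [run' jB jmin jT]]]].
by exists B', T', j; split => //; rewrite finset.in_setU jT orbT.
Qed.

Lemma cost_le f A sigma : rounds f A -> cost (weight A) sigma <= e.+1%:R * n%:R.
Proof.
move=> fA; rewrite mulr_natr -[n in leRHS]card_ord -sumr_const.
by apply: ler_sum => i _; exact: weight_le fA.
Qed.

Lemma cost_ge0 f A sigma : rounds f A -> 0 <= cost (weight A) sigma.
Proof. by move=> fA; apply: sumr_ge0 => i _; exact: weight_ge0 fA. Qed.

Hypothesis N_div : forall s, (0 < s <= n)%N -> (s ^ e %| N)%N.
Hypothesis e0 : (0 < e)%N.

Lemma inv_pow_le (s : nat) : (1 < s)%N -> s%:R ^- e <= s.-1%:R ^- e :> R.
Proof.
move=> s1; have s0 : (0 < s)%N by lia.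
have sp0 : (0 < s.-1)%N by lia.
rewrite lef_pV2 ?posrE ?exprn_gt0 ?ltr0n//.
by rewrite lerXn2r ?nnegrE ?ler0n// ler_nat leq_pred.
Qed.

Lemma row_bound_ge0 i S f : 0 <= row_bound R i S f.
Proof.
rewrite mulr_ge0 ?ler0n// addr_ge0 ?invr_ge0 ?exprn_ge0 ?ler0n// big_seq sumr_ge0// => s.
rewrite mem_index_iota => /andP[s1 _].
by rewrite mulr_ge0 ?ler0n// subr_ge0 inv_pow_le.
Qed.

Lemma weight_row_bound f A i j S : rounds f A ->
  (forall j', in_box (grid_box f i : {ffun 'I_e.+1.-1 -> _}) j' ->
     weight A (cons_index i j) <= weight A (cons_index i j')) ->
  (0 < S <= n)%N -> weight A (cons_index i j) <= row_bound R i S f.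
Proof.
move=> fA jmin /andP[S0 Sn].
have d0 : 0 < e.+1%:R :> R by rewrite ltr0n.
rewrite /row_bound mulrC -ler_pdivrMr//.
(* Scale 1 is free because every weight is at most [e.+1]. At a scale not missed, the minimum is at
   most the weight of the hit entry, and divisibility of [N] makes the threshold exactly
   [s ^ -e]. *)
apply: (level_sum (x := fun s => s%:R ^- e) (m := fun s => miss (N %/ s ^ e) i (grid_box f i) f)) => //.
- exact: inv_pow_le.
- by rewrite expr1n invr1 ler_pdivrMr// mul1r; exact: weight_le fA.
move=> s /andP[s1 sS] /negPn/existsP[j' /andP[/forallP j'B hj']].
rewrite ler_pdivrMr// mulrC; apply: (le_trans (jmin j' j'B)).
have := hit_weight fA hj'; rewrite threshold_ratio//; first lia.
by apply: N_div; lia.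
Qed.

(** Rows of the completion are charged the maximal weight [e.+1], and a near tie, after which the
    choices are unknown, the maximal total cost. *)
Definition greedy_bound m (S : nat -> nat) f : R :=
  \sum_(i < n | (i < m)%N) row_bound R i (S (n - i)%N) f
  + (e.+1%:R * (n - m)%:R + e.+1%:R * n%:R * (near_tie f)%:R).

Lemma greedy_bound_ge0 m S f : 0 <= greedy_bound m S f.
Proof.
apply: addr_ge0; first by apply: sumr_ge0 => i _; exact: row_bound_ge0.
by rewrite addr_ge0// ?mulr_ge0 ?ler0n.
Qed.

Lemma cost_greedy_bound f A m S sigma : rounds f A -> (m <= n)%N ->
  (forall k, (0 < k)%N -> (0 < S k <= k)%N) ->
  greedy_output (weight A) m sigma -> cost (weight A) sigma <= greedy_bound m S f.
Proof.
move=> fA mn Sk [B [T [run sT]]].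
have rows0 : 0 <= \sum_(i < n | (i < m)%N) row_bound R i (S (n - i)%N) f.
  by rewrite sumr_ge0// => i _; exact: row_bound_ge0.
have [tie|ntie] := boolP (near_tie f).
  apply: (le_trans (cost_le sigma fA)); rewrite /greedy_bound tie mulr1 addrA lerDr.
  by rewrite addr_ge0// mulr_ge0 ?ler0n.
rewrite /greedy_bound (negbTE ntie) mulr0 addr0 /cost (bigID (fun i : 'I_n => i < m)%N)/=.
apply: lerD.
  apply: ler_sum => i im; have [B' [T' [j [run' jB jmin jT]]]] := greedy_run_row run im.
  have -> : [ffun r => sigma r i] = j by apply/ffunP => r; rewrite ffunE (sT _ _ jT).
  have B'E := greedy_run_box (rounds_weight fA) ntie run'.
  rewrite B'E in jmin; apply: weight_row_bound => //.
  have := Sk (n - i)%N; rewrite subn_gt0 ltn_ord => /(_ isT)/andP[-> H].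
  by apply: leq_trans H _; exact: leq_subr.
apply: (@le_trans _ _ (\sum_(i < n | ~~ (i < m)%N) e.+1%:R)).
  by apply: ler_sum => i _; exact: weight_le fA.
rewrite sumr_const -[_ *+ _]mulr_natr ler_wpM2l ?ler0n// ler_nat.
have := cardsC [set i : 'I_n | (i < m)%N]%SET; rewrite card_ord_lt// card_ord => cE.
apply: (@leq_trans #|~: [set i : 'I_n | (i < m)%N]%SET|).
  by apply/subset_leq_card/fintype.subsetP => i im; rewrite !inE.
by rewrite -(leq_add2l m) cE subnKC.
Qed.

End Discretized.

(** * Real roots and the number of rounds *)

Section Roots.
Variables (R : realType) (e : nat).
Notation root n := ((n%:R : R) `^ (e.+1%:R^-1)).

Lemma powR_rootK (x : R) (m : nat) : 0 <= x -> (0 < m)%N -> (x `^ m%:R^-1) ^+ m = x.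
Proof.
move=> x0 m0; rewrite -powR_mulrn ?powR_ge0// -powRrM mulVf ?powRr1//.
by rewrite pnatr_eq0 -lt0n.
Qed.

Lemma root_ge1 n : (0 < n)%N -> 1 <= root n.
Proof.
move=> n0; apply: (@le_trans _ _ (1 `^ e.+1%:R^-1)); first by rewrite powR1.
apply: ge0_ler_powR.
- by rewrite invr_ge0 ler0n.
- by rewrite nnegrE ler01.
- by rewrite nnegrE ler0n.
- by rewrite ler1n.
Qed.

Lemma root_bounds (k S : nat) : (S ^ e.+1 <= k < S.+1 ^ e.+1)%N ->
  S%:R <= root k < S.+1%:R.
Proof.
move=> /andP[lo hi].
have rk : root k ^+ e.+1 = k%:R by rewrite powR_rootK ?ler0n.
apply/andP; split.
  by rewrite -(@ler_pXn2r _ e.+1) ?nnegrE ?powR_ge0 ?ler0n// rk -natrX ler_nat.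
by rewrite -(@ltr_pXn2r _ e.+1) ?nnegrE ?powR_ge0 ?ler0n// rk -natrX ltr_nat.
Qed.

(** Makes the row bounds telescope. For the roots [a] of [k] and [b] of [k - 1], [1 = a ^ e.+1 - b ^
    e.+1 <= e.+1 (a - b) a ^ e], and [a <= 2 S]. *)
Lemma inv_pow_root_gap (k S : nat) : (0 < S)%N -> (S ^ e.+1 <= k < S.+1 ^ e.+1)%N ->
  S%:R ^- e <= 2 ^+ e * e.+1%:R * (root k - root k.-1).
Proof.
move=> S0 Sk; have /andP[_ aS] := root_bounds Sk.
have k0 : (0 < k)%N by case/andP: Sk => + _; apply: leq_trans; rewrite expn_gt0 S0.
have a1 := root_ge1 k0; set a := root k in aS a1 *; set b := root k.-1.
have a0 : 0 < a by lra.
have S0R : 0 < S%:R :> R by rewrite ltr0n.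
have b0 : 0 <= b by exact: powR_ge0.
have ba : b <= a.
  by apply: ge0_ler_powR; rewrite ?nnegrE ?invr_ge0 ?ler0n// ler_nat leq_pred.
have gap : 1 <= e.+1%:R * (a - b) * a ^+ e.
  have E : a ^+ e.+1 - b ^+ e.+1 = 1.
    by rewrite /a /b !powR_rootK ?ler0n// -{1}(prednK k0) -natr1 addrAC subrr add0r.
  by have := subrX_le e.+1 b0 ba; rewrite E.
have aS2 : a <= 2 * S%:R.
  by have : 1 <= S%:R :> R; [rewrite ler1n|move: aS; rewrite -natr1; lra].
have H : S%:R ^- e <= 2 ^+ e / a ^+ e.
  rewrite -[leRHS]invrK invf_div lef_pV2 ?posrE ?divr_gt0 ?exprn_gt0//.
  by rewrite ler_pdivrMr ?exprn_gt0// -exprMn lerXn2r ?nnegrE ?mulr_ge0 ?(ltW a0) ?ler0n// mulrC.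
apply: (le_trans H); rewrite ler_pdivrMr ?exprn_gt0// -!mulrA ler_peMr ?exprn_ge0//.
by rewrite mulrA.
Qed.

Lemma sum_root_gap n : \sum_(i < n) (root (n - i)%N - root (n - i).-1%N) = root n.
Proof.
rewrite (reindex_inj rev_ord_inj)/=.
rewrite (eq_bigr (fun i : 'I_n => root i.+1 - root i)); last first.
  by move=> i _; rewrite subKn.
rewrite -(big_mkord xpredT (fun i => root i.+1 - root i)) telescope_sumr//.
by rewrite powR0 ?subr0// invr_eq0 pnatr_eq0.
Qed.

(** With [c = n ^ (1 / e.+2)], the side [n - i] stays at least [c] in all rounds, as the union bound
    requires, and fewer than [c + 1] rows remain. *)
Lemma greedy_rounds_spec n : (0 < n)%N -> let m := greedy_rounds R e.+1 n in
  [/\ (m <= n)%N, forall i, (i < m)%N -> (n <= (n - i) ^ e.+2)%N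
    & (n - m)%:R <= 2 * root n].
Proof.
move=> n0 m; set c : R := n%:R `^ e.+2%:R^-1.
have c0 : 0 <= c by exact: powR_ge0.
have cE : c ^+ e.+2 = n%:R by rewrite powR_rootK ?ler0n.
have n1 : 1 <= n%:R :> R by rewrite ler1n.
have c_root : c <= root n.
  apply: ler_powR => //; rewrite lef_pV2 ?posrE ?ltr0n// ler_nat//.
have c_n : c <= n%:R.
  rewrite -[leRHS]powRr1 ?ler0n//; apply: ler_powR => //.
  by rewrite invf_le1 ?ltr0n// ler1n.
have /andP[m1 m2] : m%:R <= n%:R - c < m.+1%:R by apply: truncn_itv; rewrite subr_ge0.
have mn : (m <= n)%N by rewrite -(ler_nat R); lra.
split => //.
  move=> i im; rewrite -(ler_nat R) natrX -cE lerXn2r ?nnegrE ?ler0n// natrB; last lia.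
  have : i.+1%:R <= m%:R :> R by rewrite ler_nat.
  rewrite -natr1; lra.
rewrite natrB//; have := root_ge1 n0; move: m2; rewrite -natr1; lra.
Qed.

End Roots.

(** * Averages of the upper and lower cost bounds *)

Section Expectation.
Variables (R : realType) (e : nat).
Hypothesis e2 : (2 <= e)%N.
Notation root n := ((n%:R : R) `^ (e.+1%:R^-1)).

Definition root_floor (k : nat) : nat := xchoose (nat_root k (ltn0Sn e)).

Lemma root_floorP k : (root_floor k ^ e.+1 <= k < (root_floor k).+1 ^ e.+1)%N.
Proof. exact: xchooseP (nat_root k (ltn0Sn e)). Qed.

Lemma root_floor_bounds k : (0 < k)%N -> (0 < root_floor k <= k)%N.
Proof.
move=> k0; have /andP[lo hi] := root_floorP k; apply/andP; split.
  by case: (root_floor k) hi => //; rewrite exp1n; lia.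
apply: leq_trans lo; case: (root_floor k) => // S.
by rewrite -[leqLHS]expn1 leq_pexp2l.
Qed.

(** The factorial makes every threshold [N / s ^ e] with [s <= n] integral; the other factors keep
    the mean cost of near ties at most 1. *)
Definition grid_size (n : nat) : nat :=
  (e.+1 * n ^ (2 * e).+2 * (2 * e.+1).+1 * n`! ^ e)%N.

Lemma grid_size_gt0 n : (0 < n)%N -> (0 < grid_size n)%N.
Proof. by move=> n0; rewrite /grid_size 3!muln_gt0 !expn_gt0 n0 fact_gt0. Qed.

Lemma grid_size_div n s : (0 < s <= n)%N -> (s ^ e %| grid_size n)%N.
Proof.
by move=> sn; rewrite /grid_size; apply: dvdn_mull; apply: dvdn_exp2r; exact: dvdn_fact. Qed.

Definition greedy_cst : R :=
  e.+1%:R * ((1 + level_cst R e) * (2 ^+ e * e.+1%:R) + e%:R * 2 ^+ e)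
    + 2 * e.+1%:R + 1.

(** As [k ^ e.+2 >= n] in each round, the size of [n] keeps every integer root at least [S0]. The
    terms [S ^ -e] telescope to [root n], and at most [n] errors of order [1 / n] add up to a
    constant. *)
Lemma avg_greedy_bound n S0 :
  (forall S, (S0 <= S)%N -> ((2 * S) ^ (e.+1 * e.+2 * e.+2 * 8 ^ e) <= 2 ^ S)%N) ->
  (4 <= S0)%N -> (0 < n)%N -> (S0 ^ (e.+1 * e.+2) <= n)%N ->
  avg (@greedy_bound R e n (grid_size n) (greedy_rounds R e.+1 n) root_floor)
    <= greedy_cst * root n.
Proof.
move=> HS S04 n0 Sn; set N := grid_size n; set m := greedy_rounds R e.+1 n.
have N0 : (0 < N)%N by exact: grid_size_gt0.
have [mn rows rest] := greedy_rounds_spec R e n0; rewrite -/m in mn rows rest.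
have r1 : 1 <= root n by exact: root_ge1.
have d0 : 0 <= e.+1%:R :> R by exact: ler0n.
have env0 : (0 < #|{: {ffun 'I_e.+1 * sub_index e.+1 n -> 'I_N}}|)%N.
  by rewrite card_ffun card_ord expn_gt0 N0.
have K0 : 0 <= 1 + level_cst R e.
  by rewrite addr_ge0// /level_cst !mulr_ge0 ?addr_ge0 ?exprn_ge0 ?mulr_ge0 ?ler0n.
rewrite /greedy_bound !avgD avg_sum avg_cst// avgZ.
have tie : e.+1%:R * n%:R * avg (fun f : {ffun 'I_e.+1 * sub_index e.+1 n -> 'I_N} => (near_tie f)%:R)
    <= 1 :> R.
  apply: le_trans (ler_wpM2l _ (avg_near_tie _ _ _ N0)) _; first by rewrite mulr_ge0 ?ler0n.
  rewrite mulrA ler_pdivrMr ?ltr0n// mul1r -!natrM ler_nat /N /grid_size.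
  rewrite (_ : e.+1 * n * _ = e.+1 * n ^ (2 * e).+2 * (2 * e.+1).+1)%N; last first.
    by rewrite [in RHS]expnS !mulnA.
  by rewrite leq_pmulr// expn_gt0 fact_gt0.
have row (i : 'I_n) : (i < m)%N -> avg (@row_bound R e n N i (root_floor (n - i)%N)) <=
    e.+1%:R * ((1 + level_cst R e) * (2 ^+ e * e.+1%:R * (root (n - i)%N - root (n - i).-1%N))
      + e%:R * 2 ^+ e / n%:R).
  move=> im; have nk := rows i im.
  have /andP[lo hi] := root_floorP (n - i).
  have SS0 : (S0 <= root_floor (n - i))%N.
    have : (S0 ^ e.+1 <= n - i)%N.
      by rewrite -(@leq_exp2r _ _ e.+2)// -expnM; apply: leq_trans nk.
    by move=> /leq_ltn_trans/(_ hi); rewrite ltn_exp2r.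
  apply: le_trans (avg_row_bound _ e2 N0 _ (HS _ SS0) _ lo hi nk) _.
  - by move=> s; exact: grid_size_div.
  - exact: leq_trans SS0.
  rewrite ler_wpM2l// lerD2r ler_wpM2l//; apply: inv_pow_root_gap; last exact: root_floorP.
  by apply: leq_trans SS0; lia.
have rows_sum : \sum_(i < n | (i < m)%N) avg (@row_bound R e n N i (root_floor (n - i)%N)) <=
    e.+1%:R * ((1 + level_cst R e) * (2 ^+ e * e.+1%:R) + e%:R * 2 ^+ e) * root n.
  apply: le_trans (ler_sum _ row) _.
  apply: (@le_trans _ _ (\sum_(i < n) e.+1%:R * ((1 + level_cst R e) *
      (2 ^+ e * e.+1%:R * (root (n - i)%N - root (n - i).-1%N)) + e%:R * 2 ^+ e / n%:R))).
    rewrite [leRHS](bigID (fun i : 'I_n => (i < m)%N))/= lerDl sumr_ge0// => i _.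
    rewrite mulr_ge0// addr_ge0 ?mulr_ge0 ?exprn_ge0 ?invr_ge0 ?ler0n// subr_ge0.
    by apply: ge0_ler_powR; rewrite ?nnegrE ?invr_ge0 ?ler0n// ler_nat leq_pred.
  rewrite -mulr_sumr big_split/= -!mulr_sumr sum_root_gap sumr_const card_ord.
  rewrite -[_^-1 *+ n]mulr_natr mulVf ?pnatr_eq0 -?lt0n// mulr1.
  rewrite -[leRHS]mulrA ler_wpM2l// [leRHS]mulrDl !mulrA lerD2l.
  by rewrite ler_peMr// mulr_ge0 ?exprn_ge0 ?ler0n.
have last_rows : e.+1%:R * (n - m)%:R <= 2 * e.+1%:R * root n :> R.
  by rewrite (mulrC 2) -mulrA ler_wpM2l.
apply: le_trans (lerD rows_sum (lerD last_rows tie)) _.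
by rewrite /greedy_cst [leRHS]mulrDl mul1r [X in _ <= X + _]mulrDl -addrA !lerD2l.
Qed.

(** A row in which no entry has all summands rounded to 0 costs at least [1 / N]: the mesh itself is
    the threshold. *)
Definition miss_bound n N (f : {ffun 'I_e.+1 * sub_index e.+1 n -> 'I_N}) : R :=
  N%:R^-1 * \sum_(i < n) (miss 1 i [ffun=> [set: 'I_n]%SET] f)%:R.

(** A row has [n ^ e / N ^ e.+1 <= 1 / 2] hits on average, so the mean is at least [n / (2 N)],
    where [N <= 2 (2 root n) ^ e]. *)
Lemma avg_miss_bound n N : (0 < n)%N -> (N = 2 * (root_floor n).+1 ^ e)%N ->
  (4 * 2 ^+ e)^-1 * root n <= avg (@miss_bound n N).
Proof.
move=> n0 NE; have /andP[lo hi] := root_floorP n.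
have /andP[S0 _] := root_floor_bounds n0; set S := root_floor n in NE lo hi S0.
have N0 : (0 < N)%N by rewrite NE muln_gt0 expn_gt0.
have N0R : 0 < N%:R :> R by rewrite ltr0n.
have env0 : (0 < #|{: {ffun 'I_e.+1 * sub_index e.+1 n -> 'I_N}}|)%N.
  by rewrite card_ffun card_ord expn_gt0 N0.
have half (i : 'I_n) : 2^-1 <=
    avg (fun f : {ffun 'I_e.+1 * sub_index e.+1 n -> 'I_N} =>
      (miss 1 i [ffun=> [set: 'I_n]%SET] f)%:R) :> R.
  have hits : avg (fun f : {ffun 'I_e.+1 * sub_index e.+1 n -> 'I_N} =>
      [exists j, predT j && hit 1 i j f]%:R) <= 2^-1 :> R.
    apply: le_trans (avg_exists _ _ _) _.
    rewrite (eq_bigr (fun=> (1 / N%:R) ^+ e.+1)); last by move=> j _; rewrite avg_hit.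
    rewrite sumr_const card_ffun !card_ord -[_ *+ _]mulr_natl mul1r exprVn.
    rewrite ler_pdivrMr ?exprn_gt0// mulrC ler_pdivlMr// -natrX -natrM ler_nat NE.
    rewrite expnMn -expnM mulnC; apply: leq_mul; first by rewrite -[leqLHS]expn1 leq_pexp2l.
    rewrite [(e * e.+1)%N]mulnC expnM; apply: leq_exp2rW; exact: ltnW.
  rewrite (@eq_avg _ _ _ (fun f => 1 + - 1 * [exists j, predT j && hit 1 i j f]%:R)); last first.
    move=> f; rewrite /miss; set b1 := [exists j, _]; set b2 := [exists j, _].
    have -> : b1 = b2.
      apply: eq_existsb => j; have -> // : [forall r, j r \in [ffun=> [set: 'I_n]%SET] r].
      by apply/forallP => r; rewrite ffunE finset.in_setT.
    by case: b2; rewrite ?mulr1 ?mulr0 ?subrr ?addr0.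
  by rewrite avgD avg_cst// avgZ; lra.
rewrite /miss_bound avgZ avg_sum.
apply: (@le_trans _ _ (N%:R^-1 * (n%:R * 2^-1))); last first.
  rewrite ler_wpM2l ?invr_ge0 ?ler0n// -[n in leLHS]card_ord mulr_natl -sumr_const.
  by apply: ler_sum => i _; exact: half.
have /andP[Sr rS] := root_bounds R (root_floorP n); rewrite -/S in Sr rS.
have r0 : 0 < root n by apply: lt_le_trans Sr; rewrite ltr0n.
have Ne : N%:R <= 2 * (2 ^+ e * root n ^+ e) :> R.
  rewrite NE natrM natrX ler_wpM2l// -exprMn lerXn2r ?nnegrE ?mulr_ge0 ?ler0n ?(ltW r0)//.
  have : 1 <= S%:R :> R by rewrite ler1n.
  by rewrite -natr1; lra.
rewrite ler_pdivlMl// -{2}(@powR_rootK R n%:R e.+1)// exprS.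
have -> : root n * root n ^+ e * 2^-1 = 2 * (2 ^+ e * root n ^+ e) * ((4 * 2 ^+ e)^-1 * root n).
  have : 0 < 2 ^+ e :> R by exact: exprn_gt0.
  by move: (2 ^+ e) => u u0; field; rewrite lt0r_neq0.
by rewrite ler_wpM2r// mulr_ge0 ?invr_ge0 ?mulr_ge0 ?exprn_ge0 ?(ltW r0).
Qed.

End Expectation.

(** * Measurability of the costs *)

Section Measurability.
Local Open Scope classical_set_scope.
Variables (R : realType) (d n : nat) (dO : measure_display) (Omega : measurableType dO).
Variables (P : probability Omega R) (A : 'I_d -> sub_index d n -> {RV P >-> R}).
Let W (w : Omega) : multi_index d n -> R := weight (fun j t => A j t w).

Lemma measurable_cost sigma : measurable_fun setT (fun w => cost (W w) sigma).
Proof. by apply: measurable_sum => i; apply: measurable_sum => j. Qed.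

Lemma measurable_min_cost : measurable_fun setT (fun w => min_cost (W w)).
Proof.
rewrite /min_cost; elim: (index_enum _) => [|sigma s IH].
  by under eq_fun do rewrite big_nil; exact: measurable_cost.
under eq_fun do rewrite big_cons; apply: measurable_minr => //.
exact: measurable_cost.
Qed.

(** [sigma] takes finitely many values, so the cost splits over the indicators of its level sets. *)
Lemma measurable_cost_choice (sigma : Omega -> perms d n) :
  (forall s, measurable (sigma @^-1` [set s])) ->
  measurable_fun setT (fun w => cost (W w) (sigma w)).
Proof.
move=> msigma.
have -> : (fun w => cost (W w) (sigma w)) =
    (fun w => \sum_(s : perms d n) cost (W w) s * \1_(sigma @^-1` [set s]) w).
  apply/funext => w; rewrite (bigD1 (sigma w))//= indicE mem_set// mulr1 big1 ?addr0// => s sw.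
  by rewrite indicE memNset ?mulr0//= => E; rewrite -E eqxx in sw.
apply: measurable_sum => s; apply: measurable_funM; first exact: measurable_cost.
exact: measurable_indic.
Qed.

End Measurability.

Lemma min_cost_ge (R : realType) (d n : nat) (W : multi_index d n -> R) (c : R) :
  (forall sigma, c <= cost W sigma) -> c <= min_cost W.
Proof.
move=> cW; rewrite /min_cost; elim/big_ind: _ => // x y cx cy.
by rewrite le_min cx cy.
Qed.

Lemma miss_bound_cost (R : realType) (e n N : nat) (N0 : (0 < N)%N)
    (f : {ffun 'I_e.+1 * sub_index e.+1 n -> 'I_N}) (A : 'I_e.+1 -> sub_index e.+1 n -> R) sigma :
  rounds f A -> miss_bound R f <= cost (weight A) sigma.
Proof.
move=> fA; rewrite /miss_bound mulr_sumr; apply: ler_sum => i _.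
have [mi|_] := boolP (miss 1 i _ f); last by rewrite mulr0 (weight_ge0 _ _ fA).
rewrite mulr1 (nhit_weight N0 fA)//; move: mi; rewrite /miss negb_exists => /forallP/(_ [ffun r => sigma r i]).
apply: contraNN => ->; rewrite andbT; apply/forallP => r.
by rewrite !ffunE finset.in_setT.
Qed.

Local Open Scope classical_set_scope.

Theorem theorem3 (R : realType) (d : nat) (hd : (3 <= d)%N) :
  exists c C : R, [/\ 0 < c, 0 < C &
    forall (n : nat) (hn : (1 <= n)%N)
      (dO : measure_display) (Omega : measurableType dO)
      (P : probability Omega R)
      (A : 'I_d -> sub_index d n -> {RV P >-> R})
      (hindep : mutually_independent
        (fun p : 'I_d * sub_index d n => A p.1 p.2))
      (hunif : forall j t, uniform01 (A j t)),
    let W (w : Omega) : multi_index d n -> R := weight (fun j t => A j t w) in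
    ((c * n%:R `^ (d%:R^-1))%:E <= 'E_P[fun w => min_cost (W w)])%E /\
    (forall sigma : Omega -> perms d n,
       (forall s, measurable (sigma @^-1` [set s])) ->
       (forall w, greedy_output (W w) (greedy_rounds R d n) (sigma w)) ->
       ('E_P[fun w => cost (W w) (sigma w)] <= (C * n%:R `^ (d%:R^-1))%:E)%E)].
Proof.
case: d hd => // e e2; rewrite ltnS in e2.
have [S1 HS1] := exp_beats_poly (e.+1 * e.+2 * e.+2 * 8 ^ e).
pose S0 := maxn S1 4; pose n0 := (S0 ^ (e.+1 * e.+2))%N.
have K0 : 0 <= level_cst R e.
  by rewrite /level_cst !mulr_ge0 ?addr_ge0 ?exprn_ge0 ?mulr_ge0 ?ler0n.
have G0 : 0 < greedy_cst R e.
  by rewrite ltr_wpDl// addr_ge0 ?mulr_ge0 ?addr_ge0 ?mulr_ge0 ?addr_ge0 ?exprn_ge0 ?ler0n.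
(* The first constant is that of [avg_miss_bound]; the summand [e.+1 * n0] absorbs the finitely many
   [n < n0]. *)
exists (4 * 2 ^+ e)^-1, (greedy_cst R e + e.+1%:R * n0%:R); split.
- by rewrite invr_gt0 mulr_gt0// exprn_gt0.
- by rewrite ltr_wpDr// mulr_ge0 ?ler0n.
move=> n n1 dO Omega P A indep unif W.
have unif' (p : 'I_e.+1 * sub_index e.+1 n) : uniform01 (A p.1 p.2) by exact: unif.
have roundsP N (N0 : (0 < N)%N) (f : {ffun 'I_e.+1 * sub_index e.+1 n -> 'I_N}) w :
    grid_cell (fun p => A p.1 p.2) f w -> rounds f (fun l t => A l t w).
  by move=> fw l t; exact: (grid_cellP N0 fw (l, t)).
have r1 := root_ge1 R e n1.
split=> [|sigma msigma greedy].
  (* A coarse grid whose mesh has the order [n ^ (- e / e.+1)] of the row minimum. *)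
  pose N := (2 * (root_floor e n).+1 ^ e)%N.
  have N0 : (0 < N)%N by rewrite muln_gt0 expn_gt0.
  apply: le_trans (_ : (avg (@miss_bound R e n N))%:E <= _)%E.
    by rewrite lee_fin avg_miss_bound.
  apply: (expectation_ge_grid indep unif' N0); first exact: measurable_min_cost.
    by move=> f; rewrite mulr_ge0 ?invr_ge0 ?ler0n// sumr_ge0.
  move=> f w fw; apply: min_cost_ge => s; apply: miss_bound_cost => //; exact: roundsP.
pose N := grid_size e n; have N0 : (0 < N)%N by exact: grid_size_gt0.
(* For [n < n0] the trivial bound [e.+1 * n] suffices, since the root of [n] is at least 1. *)
have [small|large] := ltnP n n0.
  apply: le_trans (_ : (avg (fun _ : {ffun 'I_e.+1 * sub_index e.+1 n -> 'I_N} => e.+1%:R * n%:R : R))%:E <= _)%E.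
    apply: (expectation_le_grid indep unif' N0); first exact: measurable_cost_choice.
      by move=> f; rewrite mulr_ge0 ?ler0n.
    move=> f w /(roundsP _ N0) fA.
    by rewrite (cost_ge0 N0 _ fA) (cost_le N0 _ fA).
  rewrite lee_fin avg_cst ?card_ffun ?card_ord ?expn_gt0 ?N0// mulrDl.
  apply: (@le_trans _ _ (e.+1%:R * n0%:R * n%:R `^ e.+1%:R^-1)); last first.
    by rewrite lerDr mulr_ge0 ?powR_ge0 ?ltW.
  rewrite -mulrA ler_wpM2l ?ler0n//; apply: (@le_trans _ _ n0%:R); first by rewrite ler_nat ltnW.
  by rewrite ler_peMr ?ler0n.
apply: le_trans (_ : (avg (@greedy_bound R e n N (greedy_rounds R e.+1 n) (root_floor e)))%:E <= _)%E.
  apply: (expectation_le_grid indep unif' N0); first exact: measurable_cost_choice.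
    by move=> f; apply: greedy_bound_ge0 => //; [exact: ltnW].
  move=> f w /(roundsP _ N0) fA; apply/andP; split; first exact: (cost_ge0 N0 _ fA).
  have [mn _ _] := greedy_rounds_spec R e n1.
  apply: (cost_greedy_bound N0 (@grid_size_div e n) (ltnW e2) fA mn) (greedy w).
  exact: root_floor_bounds.
rewrite lee_fin.
have HS S : (S0 <= S)%N -> ((2 * S) ^ (e.+1 * e.+2 * e.+2 * 8 ^ e) <= 2 ^ S)%N.
  by move=> S0S; apply: HS1; apply: leq_trans S0S; exact: leq_maxl.
apply: le_trans (avg_greedy_bound R e2 HS (leq_maxr _ _) n1 large) _.
by rewrite [leRHS]mulrDl lerDl !mulr_ge0 ?powR_ge0 ?ler0n.
Qed.
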